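(* Let $1\le p<\infty$ and let $T_f$ be a dissipative composition operator of bounded distortion on $L^p(X,\mathcal B,\mu)$. If $T_f$ is hypercyclic, then the set $HC(T_f)$ of hypercyclic vectors of $T_f$ is spaceable.
   Context: Setting. $(X,\mathcal B,\mu)$ is a $\sigma$-finite measure space and $f:X\to X$ is a bijective bimeasurable map (images and preimages of sets in $\mathcal B$ are in $\mathcal B$) such that there is $c>0$ with $\mu(f^{-1}(B))\le c\,\mu(B)$ and $\mu(f(B))\le c\,\mu(B)$ for every $B\in\mathcal B$. For $1\le p<\infty$, the composition operator induced by $f$ is the bounded linear operator $T_f:L^p(X,\mathcal B,\mu)\to L^p(X,\mathcal B,\mu)$, $T_f\varphi=\varphi\circ f$; it is invertible with $T_f^{-1}=T_{f^{-1}}$. The space $L^p(X,\mathcal B,\mu)$ is complex and assumed separable. $T_f$ is dissipative if there is a wandering set $W\in\mathcal B$ (the sets $f^k(W)$, $k\in\mathbb Z$, are pairwise disjoint) with $0<\mu(W)<\infty$ and $X=\bigcup_{k\in\mathbb Z}f^k(W)$. It is moreover of bounded distortion if, for such a $W$, there exists $K>0$ such that $$\frac1K\,\mu(f^k(W))\,\mu(B)\le \mu(f^k(B))\,\mu(W)\le K\,\mu(f^k(W))\,\mu(B)$$ for all $k\in\mathbb Z$ and all $B\in\mathcal B$ with $B\subseteq W$. For a bounded linear operator $T$ on a separable Banach space $Y$, a vector $y\in Y$ is hypercyclic if its orbit $\{T^ny:n\ge0\}$ is dense in $Y$; $HC(T)$ is the set of hypercyclic vectors, and $T$ is hypercyclic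 if $HC(T)\neq\emptyset$. A set $M\subseteq Y$ is spaceable if $M\cup\{0\}$ contains a closed infinite-dimensional vector subspace of $Y$. *)

(* Defs.v *)
From HB Require Import structures.
From mathcomp Require Import all_boot all_order all_algebra.
From mathcomp Require Import generic_quotient ring_quotient complex.
From mathcomp Require Import all_classical all_reals all_analysis.
From mathcomp Require Import measurable_realfun.

Set Implicit Arguments.
Unset Strict Implicit.
Unset Printing Implicit Defensive.

Import Order.TTheory GRing.Theory Num.Theory.
Import numFieldNormedType.Exports.
Import ComplexField.Normc.

Local Open Scope classical_set_scope.
Local Open Scope ring_scope.
Local Open Scope complex_scope.
Local Open Scope quotient_scope.

Section complex_Lfun.
Context d (T : measurableType d) (R : realType).
Variables (mu : {measure set T -> \bar R}) (p : R).
Implicit Types f g : T -> R[i].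

(* [R[i]] carries no sigma-algebra in the library; measurability of the real
   and imaginary parts is Borel measurability with respect to [C = R^2]. *)
Definition cmeasurable f :=
  measurable_fun setT (fun x => complex.Re (f x)) /\
  measurable_fun setT (fun x => complex.Im (f x)).

Definition cLnorm f : \bar R := 'N[mu]_p%:E[EFin \o (@normc R \o f)].

Definition cLfun : {pred T -> R[i]} :=
  mem [set f | cmeasurable f /\ (cLnorm f < +oo)%E].

Lemma cLfunP f : reflect (cmeasurable f /\ (cLnorm f < +oo)%E) (f \in cLfun).
Proof. by apply: (iffP idP) => [/set_mem|?]; [|exact: mem_set]. Qed.

Lemma normc_ge0 (z : R[i]) : 0 <= normc z.
Proof. by case: z => a b; exact: sqrtr_ge0. Qed.

Lemma measurable_normc f : cmeasurable f ->
  measurable_fun setT (fun x => normc (f x)).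
Proof.
move=> [mr mi].
rewrite (_ : (fun x => normc (f x)) = Num.sqrt \o
  (fun x => complex.Re (f x) ^+ 2 + complex.Im (f x) ^+ 2)); last first.
  by apply/funext => x /=; case: (f x).
apply: measurableT_comp => //.
  by apply: continuous_measurable_fun; exact: sqrt_continuous.
by apply: measurable_funD; exact: measurable_funX.
Qed.

Lemma measurable_normc_powR f : cmeasurable f ->
  measurable_fun setT (fun x => (normc (f x) `^ p)%:E).
Proof.
move=> mf; apply/measurable_EFinP.
apply: (measurableT_comp (measurable_powR p)).
exact: measurable_normc.
Qed.

Lemma cmeasurableD f g : cmeasurable f -> cmeasurable g -> cmeasurable (f + g).
Proof.
move=> [fr fi] [gr gi]; split.
  rewrite (_ : (fun x => _) =
    (fun x => complex.Re (f x)) \+ (fun x => complex.Re (g x))).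
    exact: measurable_funD.
  by apply/funext => x /=; rewrite fctE; case: (f x); case: (g x).
rewrite (_ : (fun x => _) =
  (fun x => complex.Im (f x)) \+ (fun x => complex.Im (g x))).
  exact: measurable_funD.
by apply/funext => x /=; rewrite fctE; case: (f x); case: (g x).
Qed.

Lemma cmeasurableZ (a : R[i]) f : cmeasurable f -> cmeasurable (a *: f).
Proof.
case: a => a b [fr fi]; split.
  rewrite (_ : (fun x => _) =
    (a \o* (fun x => complex.Re (f x))) \- (b \o* (fun x => complex.Im (f x)))).
    by apply: measurable_funB; apply: measurable_funM.
  by apply/funext => x /=; rewrite fctE; case: (f x) => u v /=;
    rewrite ![_ * a]mulrC ![_ * b]mulrC.
rewrite (_ : (fun x => _) =
  (a \o* (fun x => complex.Im (f x))) \+ (b \o* (fun x => complex.Re (f x)))).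
  by apply: measurable_funD; apply: measurable_funM.
by apply/funext => x /=; rewrite fctE; case: (f x) => u v /=;
  rewrite ![_ * a]mulrC ![_ * b]mulrC.
Qed.

Lemma cmeasurable0 : cmeasurable 0.
Proof. by split; exact: measurable_cst. Qed.

Hypothesis p1 : 1 <= p.
Let p0 : 0 < p. Proof. exact: lt_le_trans p1. Qed.

Lemma cLnorm_ge0 f : (0 <= cLnorm f)%E. Proof. exact: Lnorm_ge0. Qed.

Lemma cLnorm_integral f :
  cLnorm f = ((\int[mu]_x (normc (f x) `^ p)%:E) `^ p^-1)%E.
Proof.
rewrite /cLnorm unlock; congr poweR; apply: eq_integral => x _.
by rewrite /= ger0_norm ?normc_ge0// ?powR_ge0.
Qed.

Lemma cLnormD f g : cmeasurable f -> cmeasurable g ->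
  (cLnorm (f + g)%R <= cLnorm f + cLnorm g)%E.
Proof.
move=> mf mg; have nf := measurable_normc mf; have ng := measurable_normc mg.
apply: le_trans (@eminkowski _ _ _ mu _ _ p%:E nf ng _) => //.
rewrite cLnorm_integral unlock; apply: gt0_ler_poweR.
- by rewrite invr_ge0 ltW.
- by rewrite in_itv/= leey integral_ge0// => x _; rewrite lee_fin powR_ge0.
- by rewrite in_itv/= leey integral_ge0.
apply: ge0_le_integral => //.
- by move=> x _; rewrite lee_fin powR_ge0.
- by apply: measurable_normc_powR; exact: cmeasurableD.
- apply/measurable_EFinP; apply: (measurableT_comp (measurable_powR p)).
  by apply: measurableT_comp => //; exact: measurable_funD.
move=> x _; rewrite lee_fin ge0_ler_powR ?(ltW p0) ?nnegrE ?normc_ge0//.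
by rewrite ger0_norm ?addr_ge0 ?normc_ge0// le_normcD.
Qed.

Lemma cLnormZ (a : R[i]) f : cmeasurable f ->
  cLnorm (a *: f) = ((normc a)%:E * cLnorm f)%E.
Proof.
move=> mf; rewrite !cLnorm_integral.
have -> : (\int[mu]_x (normc ((a *: f) x) `^ p)%:E =
           (normc a `^ p)%:E * \int[mu]_x (normc (f x) `^ p)%:E)%E.
  rewrite -ge0_integralZl_EFin ?powR_ge0//.
  - by apply: eq_integral => x _; rewrite -EFinM -powRM ?normc_ge0// -normcM.
  - by move=> x _; rewrite lee_fin powR_ge0.
  - exact: measurable_normc_powR.
rewrite poweRM ?lee_fin ?powR_ge0 ?integral_ge0//; last first.
  by move=> x _; rewrite lee_fin powR_ge0.
by rewrite poweR_EFin -powRrM mulfV ?gt_eqF// powRr1 ?normc_ge0.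
Qed.

Lemma cLnorm_eq0 f : cmeasurable f -> cLnorm f = 0%E -> f = 0 %[ae mu].
Proof.
move=> mf /Lnorm_eq0_eq0.
have /measurable_EFinP m : measurable_fun setT (fun x => normc (f x)).
  exact: measurable_normc.
move=> /(_ m); rewrite lte_fin => /(_ p0).
by apply: filterS => x + _ => /(_ I) [] /eq0_normc.
Qed.

Lemma cLnorm_ae_eq f g : cmeasurable f -> cmeasurable g ->
  f = g %[ae mu] -> cLnorm f = cLnorm g.
Proof.
move=> mf mg fg; rewrite !cLnorm_integral; congr poweR.
apply: ae_eq_integral => //; try exact: measurable_normc_powR.
by apply: filterS fg => x + _ => /(_ I) ->.
Qed.

Lemma cLfun_submod_closed : submod_closed cLfun.
Proof.
split.
  apply/cLfunP; split; first exact: cmeasurable0.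
  by have := cLnormZ 0 cmeasurable0; rewrite scale0r normc0 mul0e => ->.
move=> a f g /cLfunP[mf lf] /cLfunP[mg lg]; apply/cLfunP; split.
  by apply: cmeasurableD => //; exact: cmeasurableZ.
apply: le_lt_trans (cLnormD _ _) _ => //; first exact: cmeasurableZ.
rewrite cLnormZ// lte_add_pinfty// lte_mul_pinfty// ?lee_fin ?normc_ge0//.
Qed.

End complex_Lfun.

(* The proof [p1] is a parameter of the type so that the algebraic structures,
   which only exist for [1 <= p], can be attached to it. *)
Record cLfunType d (T : measurableType d) (R : realType)
    (mu : {measure set T -> \bar R}) (p : R) (p1 : 1 <= p) := CLfun {
  cLfun_fun :> T -> R[i] ;
  cLfun_funP : cLfun_fun \in cLfun mu p }.

Section complex_LfunType.
Context d (T : measurableType d) (R : realType).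
Variables (mu : {measure set T -> \bar R}) (p : R) (p1 : 1 <= p).
Local Notation cLfunType := (cLfunType mu p1).

HB.instance Definition _ := [isSub for @cLfun_fun d T R mu p p1].
HB.instance Definition _ := [Choice of cLfunType by <:].
HB.instance Definition _ := GRing.isSubmodClosed.Build _ _ (cLfun mu p)
  (cLfun_submod_closed mu p1).
HB.instance Definition _ := [SubChoice_isSubLmodule of cLfunType by <:].

Definition ae0 : {pred cLfunType} :=
  mem [set f : cLfunType | (f : T -> R[i]) = 0 %[ae mu]].

Lemma ae0P (f : cLfunType) :
  reflect ((f : T -> R[i]) = 0 %[ae mu]) (f \in ae0).
Proof. by apply: (iffP idP) => [/set_mem|?]; [|exact: mem_set]. Qed.

Lemma ae0_submod_closed : submod_closed ae0.
Proof.
split; first by apply/ae0P; exact: nearW.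
move=> a f g /ae0P f0 /ae0P g0; apply/ae0P.
apply: filterS2 f0 g0 => x + + _ => /(_ I) fx /(_ I) gx.
change (a * f x + g x = 0); rewrite fx gx.
change (a * 0 + 0 = 0 :> R[i]).
by rewrite mulr0 addr0.
Qed.

HB.instance Definition _ := GRing.isSubmodClosed.Build _ _ ae0
  ae0_submod_closed.

End complex_LfunType.

Section complex_Lspace.
Context d (T : measurableType d) (R : realType).
Variables (mu : {measure set T -> \bar R}) (p : R) (p1 : 1 <= p).
Local Notation ty := (cLfunType mu p1).

(* Complex [L^p], as the quotient of [cLfunType] by a.e. equality. *)
Definition cLspace := Quotient.quot (@ae0 _ T R mu p p1).

HB.instance Definition _ := GRing.Zmodule.on cLspace.
HB.instance Definition _ := EqQuotient.on cLspace.

Lemma cLspaceP (f g : ty) :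
  \pi_cLspace f = \pi_cLspace g <-> (f : T -> R[i]) = g %[ae mu].
Proof.
split=> [/eqP|fg].
  rewrite -Quotient.idealrBE => /ae0P; apply: filterS => x + _ => /(_ I).
  move=> fg; apply/eqP; rewrite -subr_eq0; apply/eqP; exact: fg.
apply/eqP; rewrite -Quotient.idealrBE; apply/ae0P.
apply: filterS fg => x + _ => /(_ I) fg.
by apply/eqP; rewrite subr_eq0; apply/eqP.
Qed.

Lemma cLspaceW (P : cLspace -> Prop) :
  (forall f, P (\pi_cLspace f)) -> forall u, P u.
Proof. exact: quotW. Qed.

Definition cLscale (a : R[i]) (u : cLspace) : cLspace :=
  \pi_cLspace (a *: repr u).

Lemma cLpiD (f g : ty) :
  \pi_cLspace (f + g) = \pi_cLspace f + \pi_cLspace g.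
Proof. by rewrite -[RHS]Quotient.pi_add. Qed.

Lemma cLscale_pi a (f : ty) : cLscale a (\pi_cLspace f) = \pi_cLspace (a *: f).
Proof.
apply/eqP; rewrite -Quotient.idealrBE -scalerBr; apply: rpredZ.
by rewrite Quotient.idealrBE reprK.
Qed.

Lemma cLscaleA a b u : cLscale a (cLscale b u) = cLscale (a * b) u.
Proof. by elim/cLspaceW: u => f; rewrite !cLscale_pi scalerA. Qed.

Lemma cLscale1 : left_id 1 cLscale.
Proof. by elim/cLspaceW => f; rewrite cLscale_pi scale1r. Qed.

Lemma cLscaleDr : right_distributive cLscale +%R.
Proof.
move=> a; elim/cLspaceW => f; elim/cLspaceW => g.
by rewrite -cLpiD !cLscale_pi -cLpiD scalerDr.
Qed.

Lemma cLscaleDl u : {morph cLscale^~ u : a b / a + b}.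
Proof.
by move=> a b; elim/cLspaceW: u => f; rewrite !cLscale_pi -cLpiD scalerDl.
Qed.

HB.instance Definition _ := GRing.Zmodule_isLmodule.Build R[i] cLspace
  cLscaleA cLscale1 cLscaleDr cLscaleDl.

Lemma cLpiZ a (f : ty) : \pi_cLspace (a *: f) = a *: \pi_cLspace f.
Proof. by rewrite -cLscale_pi. Qed.

Lemma cLpi0 : \pi_cLspace 0 = 0.
Proof. by rewrite -(scale0r 0) cLpiZ scale0r. Qed.

(* The norm of a normed module over R[i] takes its values in R[i]. *)
Definition cLspace_norm (u : cLspace) : R[i] :=
  (fine (cLnorm mu p (repr u)))%:C.

Lemma cLfun_measurable (f : ty) : cmeasurable f.
Proof. by case: f => f /= /cLfunP[]. Qed.

Lemma cLfun_fineK (f : ty) : (fine (cLnorm mu p f))%:E = cLnorm mu p f.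
Proof.
rewrite fineK// ge0_fin_numE ?cLnorm_ge0//.
by case: f => f /= /cLfunP[].
Qed.

Lemma cLspace_norm_pi (f : ty) :
  cLspace_norm (\pi_cLspace f) = (fine (cLnorm mu p f))%:C.
Proof.
rewrite /cLspace_norm (@cLnorm_ae_eq _ _ _ mu p _ f)//;
  try exact: cLfun_measurable.
by apply/cLspaceP; rewrite reprK.
Qed.

Lemma cLspace_normD u v :
  cLspace_norm (u + v) <= cLspace_norm u + cLspace_norm v.
Proof.
elim/cLspaceW: u => f; elim/cLspaceW: v => g.
rewrite -cLpiD !cLspace_norm_pi.
have : fine (cLnorm mu p (f + g)) <= fine (cLnorm mu p f) + fine (cLnorm mu p g).
  rewrite -lee_fin EFinD (cLfun_fineK (f + g)) !cLfun_fineK.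
  exact: (cLnormD mu p1 (cLfun_measurable f) (cLfun_measurable g)).
by rewrite -lecR rmorphD.
Qed.

Lemma normcC (a : R[i]) : `|a| = (normc a)%:C.
Proof. by rewrite normc_def; case: a. Qed.

Lemma cLspace_normZ (a : R[i]) u :
  cLspace_norm (a *: u) = `|a| * cLspace_norm u.
Proof.
elim/cLspaceW: u => f; rewrite -cLpiZ !cLspace_norm_pi normcC.
have -> : fine (cLnorm mu p (a *: f)) = normc a * fine (cLnorm mu p f).
  apply: EFin_inj; rewrite EFinM (cLfun_fineK (a *: f)) cLfun_fineK.
  exact: (cLnormZ mu p1 a (cLfun_measurable f)).
by rewrite rmorphM.
Qed.

Lemma cLspace_norm_eq0 u : cLspace_norm u = 0 -> u = 0.
Proof.
elim/cLspaceW: u => f; rewrite cLspace_norm_pi => -[] f0.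
rewrite -cLpi0; apply/cLspaceP.
apply: (@cLnorm_eq0 _ _ _ mu p p1 f (cLfun_measurable f)).
by rewrite -cLfun_fineK f0.
Qed.

HB.instance Definition _ := Lmodule_isNormed.Build R[i] cLspace
  cLspace_normD cLspace_normZ cLspace_norm_eq0.

Lemma cLspace_normE (f : ty) :
  `|\pi_cLspace f| = (fine (cLnorm mu p f))%:C :> R[i].
Proof. exact: cLspace_norm_pi. Qed.

End complex_Lspace.

Section linear_dynamics.
Variables (K : numFieldType) (Y : normedModType K).
Implicit Types (S : Y -> Y) (V M : set Y).

Definition separable (X : topologicalType) :=
  exists2 D : set X, countable D & dense D.

Definition hypercyclic_vectors S : set Y :=
  [set y | dense (range (fun n => iter n S y))].

Definition hypercyclic S := hypercyclic_vectors S !=set0.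

Definition linear_subspace V :=
  [/\ V 0, forall x y, V x -> V y -> V (x + y) &
      forall (a : K) x, V x -> V (a *: x)].

Definition finite_dimensional V :=
  exists (n : nat) (e : 'I_n -> Y), (forall i, V (e i)) /\
    forall x, V x -> exists a : 'I_n -> K, x = \sum_(i < n) a i *: e i.

Definition spaceable M :=
  exists V, [/\ linear_subspace V, closed V, ~ finite_dimensional V &
                V `<=` M `|` [set 0]].

End linear_dynamics.

Section composition_operator.
Context d (T : measurableType d) (R : realType).
Variable mu : {measure set T -> \bar R}.

Record composition_map (f : T -> T) : Prop := CompositionMap {
  composition_map_bij : bijective f ;
  composition_map_preim : forall B, measurable B -> measurable (f @^-1` B) ;
  composition_map_im : forall B, measurable B -> measurable (f @` B) ;
  composition_map_bound : exists2 c : R, 0 < c & forall B, measurable B ->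
    (mu (f @^-1` B) <= c%:E * mu B)%E /\ (mu (f @` B) <= c%:E * mu B)%E }.

Variables (p : R) (p1 : 1 <= p) (f : T -> T) (hf : composition_map f).
Let p0 : 0 < p. Proof. exact: lt_le_trans p1. Qed.

Lemma composition_map_measurable : measurable_fun setT f.
Proof. by move=> _ B mB; rewrite setTI; exact: composition_map_preim. Qed.

Lemma cmeasurable_comp (g : T -> R[i]) : cmeasurable g -> cmeasurable (g \o f).
Proof.
have mf := composition_map_measurable.
by move=> [gr gi]; split; [exact: (measurableT_comp gr mf)|
  exact: (measurableT_comp gi mf)].
Qed.

Lemma cLnorm_comp_le : exists2 c : R, 0 <= c & forall g : T -> R[i],
  cmeasurable g -> (cLnorm mu p (g \o f) <= c%:E * cLnorm mu p g)%E.
Proof.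
have [c c0 hc] := composition_map_bound hf.
exists (c `^ p^-1); first exact: powR_ge0.
move=> g mg; rewrite !cLnorm_integral.
rewrite -poweR_EFin -poweRM ?lee_fin ?(ltW c0)//; last first.
  by apply: integral_ge0 => x _; rewrite lee_fin powR_ge0.
set G := fun x => (normc (g x) `^ p)%:E.
have G0 x : (0 <= G x)%E by rewrite lee_fin powR_ge0.
have mG : measurable_fun setT G by exact: measurable_normc_powR.
apply: gt0_ler_poweR.
- by rewrite invr_ge0 ltW.
- by rewrite in_itv/= leey integral_ge0// => x _; rewrite lee_fin powR_ge0.
- rewrite in_itv/= leey andbT; apply: mule_ge0; first by rewrite lee_fin ltW.
  by apply: integral_ge0 => x _; exact: G0.
pose F : {mfun T >-> T} :=
  mfun_Sub (mem_set composition_map_measurable).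
have -> : (\int[mu]_x (normc ((g \o f) x) `^ p)%:E =
           \int[pushforward mu F]_x G x)%E.
  by rewrite ge0_integral_pushforward// preimage_setT.
rewrite -(@ge0_integral_mscale _ _ _ mu setT measurableT (NngNum (ltW c0)))//; last first.
  by move=> x _; exact: G0.
apply: ge0_le_measure_integral => // S mS.
by rewrite /mscale /=; case: (hc S mS).
Qed.

Lemma cLfun_compP (g : cLfunType mu p1) : (g : T -> R[i]) \o f \in cLfun mu p.
Proof.
have [c c0 hc] := cLnorm_comp_le.
case: g => g /= /cLfunP[mg lg]; apply/cLfunP; split.
  exact: cmeasurable_comp.
by apply: le_lt_trans (hc _ mg) _; rewrite lte_mul_pinfty// lee_fin.
Qed.

Definition cLfun_comp (g : cLfunType mu p1) : cLfunType mu p1 :=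
  CLfun p1 (cLfun_compP g).

Local Notation Lp := (cLspace mu p1).

Definition composition_op (u : Lp) : Lp := \pi_Lp (cLfun_comp (repr u)).

Lemma composition_op_pi (g : cLfunType mu p1) :
  composition_op (\pi_Lp g) = \pi_Lp (cLfun_comp g).
Proof.
apply/cLspaceP.
have : (repr (\pi_Lp g) : T -> R[i]) = g %[ae mu] by apply/cLspaceP; rewrite reprK.
case=> N [mN N0 sN]; exists (f @^-1` N); split.
- exact: composition_map_preim.
- have [c c0 /(_ N mN)[+ _]] := composition_map_bound hf.
  by rewrite N0 mule0 => muN; apply/eqP; rewrite eq_le muN measure_ge0.
- by move=> x /= h; apply: sN => /= e; apply: h => _; exact: e.
Qed.

Lemma composition_op_is_linear : linear composition_op.
Proof.
move=> a; elim/cLspaceW => g; elim/cLspaceW => h.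
rewrite -cLpiZ -cLpiD !composition_op_pi -cLpiZ -cLpiD.
by congr (\pi_Lp _); apply: val_inj; apply/funext.
Qed.

HB.instance Definition _ := GRing.isLinear.Build R[i] Lp Lp _ composition_op
  composition_op_is_linear.

Lemma composition_op_bounded : exists2 c : R, 0 <= c &
  forall u : Lp, `|composition_op u| <= c%:C * `|u|.
Proof.
have [c c0 hc] := cLnorm_comp_le; exists c => //.
elim/cLspaceW => g; rewrite composition_op_pi !cLspace_normE -rmorphM lecR.
rewrite -lee_fin EFinM !cLfun_fineK; apply: hc; exact: cLfun_measurable.
Qed.

Lemma composition_op_continuous : continuous composition_op.
Proof.
apply: bounded_linear_continuous; apply/bounded_funP => r.
have [c c0 hc] := composition_op_bounded.
exists (c%:C * r) => u ur; apply: le_trans (hc u) _.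
by rewrite ler_wpM2l// ler0c.
Qed.

End composition_operator.

Arguments composition_op {d T R mu p} p1 {f} hf u.

Section dissipative.
Context d (T : measurableType d) (R : realType).
Variables (mu : {measure set T -> \bar R}) (f : T -> T).

(* This is [f^k(B)] for [k : int]; when [f] is bijective, [f^(-n)(B)] is the preimage
   of [B] under [f^n]. *)
Definition iter_image (k : int) (B : set T) : set T :=
  match k with
  | Posz n => iter n f @` B
  | Negz n => iter n.+1 f @^-1` B
  end.

Definition wandering (W : set T) :=
  measurable W /\ trivIset setT (iter_image^~ W).

Definition dissipative_by (W : set T) :=
  [/\ wandering W, (0 < mu W < +oo)%E & \bigcup_k iter_image k W = setT].

Definition distortion_bounded_on (W : set T) :=
  exists2 K : R, 0 < K & forall (k : int) (B : set T),
    measurable B -> B `<=` W ->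
    (K^-1%:E * (mu (iter_image k W) * mu B) <= mu (iter_image k B) * mu W)%E /\
    (mu (iter_image k B) * mu W <= K%:E * (mu (iter_image k W) * mu B))%E.

(* The same wandering set witnesses dissipativity and bounded distortion. *)
Definition dissipative_bounded_distortion :=
  exists2 W, dissipative_by W & distortion_bounded_on W.

End dissipative.

(* Main.v *)
Require Import Defs.
From mathcomp Require Import all_boot all_order all_algebra complex.
From mathcomp Require Import all_classical all_reals all_analysis.
From mathcomp Require Import measurable_realfun zify ring lra.

(** Let E_k = f^k(W), so that X is the disjoint union of the levels E_k, and let
    m k = mu(E_k).  Bounded distortion says that f^n rescales mass from one
    level to another by the ratio of the weights, up to a constant:
    the p-th power of the norm of T^n x is at most C times the integral of
    |x|^p against the density z |-> m (k - n) / m k for z in E_k.  The operator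
    thus behaves like a weighted bilateral shift.

    Hypercyclicity forces the weights to be small far out on both sides
    simultaneously: for each e > 0 some n has m n < e and m (- n) < e
    ([hypercyclic_small]).  Two consequences drive the construction.  A function
    carried by finitely many levels can be pushed to levels near n with
    arbitrarily small norm, while T^n shrinks whatever has been placed before;
    and, since m is small somewhere far to the left, there are levels - r, as far
    to the left as desired, whose weight dominates the weights of a prescribed
    number of levels further left ([weight_peak]), so that T^l does not expand
    the functions carried by E_(- r) by more than a constant factor for all
    those l.

    Fix a hypercyclic vector h.  Choose inductively times n_t and peaks r_i such
    that the blocks of levels k with |k - n_t| <= t are pairwise disjoint and
    contain no peak ([stages], [schedule]).  One measurable function, the
    profile, is then defined piecewise: constant on each peak level, normalised
    there to have p-th power mass 1, and equal on the block of stage t to the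
    function which T^(n_t) turns into T^(power t) h.  Every peak and every block
    carries a label in nat, and each pair (label, power) recurs for infinitely
    many t.  The subspace consists of the functions in L^p of the form
    a(label) * profile, with a : nat -> C.

    It is closed because the coefficient a i is read off, with norm at most 1,
    from the peak of label i, and it is infinite dimensional because the
    coefficients are unique and arbitrary finitely supported sequences occur.
    If x is in it and a i <> 0, then along the stages t with label i and power k
    the vector T^(n_t) x coincides with a i * T^k h on the levels |l| <= t, and
    what remains is the mass of x outside block t seen after time n_t.  By the
    schedule the corresponding densities tend to 0 pointwise and stay below an
    integrable function ([density_decay], [integral_majorant_fin]), so dominated
    convergence gives T^(n_t) x -> a i * T^k h.  As k varies these limits are
    dense, and x is hypercyclic. *)

Set Implicit Arguments.
Unset Strict Implicit.
Unset Printing Implicit Defensive.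

Import Order.TTheory GRing.Theory Num.Theory.
Import numFieldNormedType.Exports.
Import ComplexField.Normc.

Local Open Scope ring_scope.

(** * Weights on the integers *)

Section weights.
Variables (R : realType) (m : int -> R) (c : R).
Hypotheses (m_gt0 : forall k, 0 < m k) (c_ge1 : 1 <= c).
Hypotheses (m_succ : forall k, m (k + 1) <= c * m k)
  (m_pred : forall k, m (k - 1) <= c * m k).
Hypothesis m_small : forall e, 0 < e -> exists n : nat, m n%:Z < e /\ m (- n%:Z) < e.

Let c_gt0 : 0 < c. Proof. exact: lt_le_trans c_ge1. Qed.

(** Consecutive weights are comparable, so j steps cost at most a power of c;
    smallness at one index therefore spreads to a window around it. *)
Lemma weight_shift (k j : int) (M : nat) : (`|j| <= M)%N ->
  m (k + j) <= c ^+ M * m k.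
Proof.
elim: M j => [|M IH] j jM.
  by rewrite (_ : j = 0) ?addr0 ?expr0 ?mul1r//; lia.
have [j0|j0] : (0 < j) \/ (j <= 0) by lia.
  have := m_succ (k + (j - 1)).
  rewrite (_ : k + (j - 1) + 1 = k + j); last by lia.
  move=> /le_trans; apply; rewrite exprS -mulrA ler_pM2l//; apply: IH; lia.
have [{}j0|{}j0] : j = 0 \/ (j < 0) by lia.
  rewrite j0 addr0 ler_peMl// ?exprn_ege1//; exact: ltW.
have := m_pred (k + (j + 1)).
rewrite (_ : k + (j + 1) - 1 = k + j); last by lia.
move=> /le_trans; apply; rewrite exprS -mulrA ler_pM2l//; apply: IH; lia.
Qed.

Lemma weight_low (N : nat) (k : int) : (`|k| <= N)%N -> m 0 / c ^+ N <= m k.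
Proof.
move=> kN; rewrite ler_pdivrMr ?exprn_gt0// mulrC.
by rewrite -[X in m X](subrr k); apply: weight_shift; lia.
Qed.

(** Smallness at n can be required on whole windows around n and - n.  That n
    exceeds N is automatic once e is below the lower bound of the weights on
    [- N, N]. *)
Lemma weight_window e (M N : nat) : 0 < e -> exists n : nat, (N < n)%N /\
  forall j : int, (`|j| <= M)%N -> m (j + n%:Z) < e /\ m (j - n%:Z) < e.
Proof.
move=> e0.
have d0 : 0 < m 0 / c ^+ N by rewrite divr_gt0 ?exprn_gt0.
have e'0 : 0 < e / c ^+ M by rewrite divr_gt0 ?exprn_gt0.
have [] := @m_small (Num.min (m 0 / c ^+ N) (e / c ^+ M)).
  by rewrite lt_min d0.
move=> n []; rewrite !lt_min => /andP[n1 n2] /andP[n3 n4].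
exists n; split.
  rewrite ltnNge; apply/negP => nN; move: n1; rewrite ltNge weight_low//.
move=> j jM; rewrite !(addrC j); split.
  apply: le_lt_trans (weight_shift _ jM) _.
  by rewrite mulrC -ltr_pdivlMr ?exprn_gt0.
apply: le_lt_trans (weight_shift _ jM) _.
by rewrite mulrC -ltr_pdivlMr ?exprn_gt0.
Qed.

(** A maximum of the weights over a long window to the left of - M cannot lie near
    the far end of the window, where the weights are below m (- M - 1); hence the
    N levels to the left of a maximal one still belong to the window. *)
Lemma weight_peak (M N : nat) : exists r : nat, (M < r)%N /\
  forall l : nat, (l <= N)%N -> m (- r%:Z - l%:Z) <= m (- r%:Z).
Proof.
have [L [ML hL]] := @weight_window (m (- M.+1%:Z)) N (M.+1 + N) (m_gt0 _).
have MLN : (M.+1 < (L + N).+1)%N by lia.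
pose i0 := Ordinal MLN.
have Pi0 : (M < i0)%N by [].
case: (@arg_maxP _ _ _ i0 (fun i : 'I_(L + N).+1 => M < i)%N
  (fun i => m (- (i : nat)%:Z)) Pi0) => r Mr rmax.
have rL : (r < L)%N.
  rewrite ltnNge; apply/negP => Lr.
  have /= := rmax i0 Pi0; rewrite leNgt => /negP; apply.
  have [_] := hL (L%:Z - r%:Z) ltac:(have := ltn_ord r; lia).
  by rewrite (_ : _ - _ - _ = - r%:Z)//; lia.
exists r; split => // l lN.
have rl : (r + l < (L + N).+1)%N by lia.
have /= := rmax (Ordinal rl) ltac:(rewrite /=; lia).
by rewrite (_ : - r%:Z - l%:Z = - (r + l)%N%:Z)//; lia.
Qed.

(** The requirements on the time n and the peak - r of stage t with tolerance e,
    when all levels used before have absolute value at most L. *)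
Definition stage (e : R) (t L n r : nat) :=
  [/\ (L + t < n)%N,
      forall k : int, (`|k| <= L + t)%N -> m (k + n%:Z) <= e,
      forall k : int, (`|k| <= L)%N -> m (k - n%:Z) <= m k,
      m (- n%:Z) <= t.+1%:R^-1 &
      (L < r)%N /\ forall l : nat, (l <= n)%N -> m (- r%:Z - l%:Z) <= m (- r%:Z)].

Lemma stage_exists e t L : 0 < e -> exists nr, stage e t L nr.1 nr.2.
Proof.
move=> e0.
pose e' := Num.min e (Num.min (m 0 / c ^+ L) t.+1%:R^-1).
have e'0 : 0 < e' by rewrite !lt_min e0 invr_gt0 ltr0n divr_gt0 ?exprn_gt0.
have [n [Ln hn]] := @weight_window e' (L + t) (L + t) e'0.
have [r [Lr hr]] := weight_peak L n.
exists (n, r); split => //=.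
- by move=> k /hn[+ _]; rewrite !lt_min => /andP[/ltW].
- move=> k kL; have [_] := hn k ltac:(lia).
  rewrite !lt_min => /and3P[_ + _] => /ltW /le_trans; apply; exact: weight_low.
- have [_] := hn 0 ltac:(lia).
  by rewrite sub0r !lt_min => /and3P[_ _ /ltW].
Qed.

(** Stages are chained by letting the bound L of a stage record all the levels
    used before it.  A peak chosen before stage s is controlled by s directly; a
    peak chosen at stage s or later dominates enough levels to its left to cover
    the time of stage s. *)
Lemma stages (eta : nat -> R) : (forall t, 0 < eta t) ->
  exists n r : nat -> nat,
  [/\ (forall t, t < n t)%N /\ (forall s t, s < t -> n s + s + t < n t)%N,
      (forall t (j : int), (`|j| <= t)%N -> m (j + (n t)%:Z) <= eta t /\
         forall s, (s < t)%N -> m (j + (n t)%:Z - (n s)%:Z) <= eta t),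
      (forall s t (j : int), (t < s)%N -> (`|j| <= t)%N ->
         m (j + (n t)%:Z - (n s)%:Z) <= m (j + (n t)%:Z)),
      [/\ forall i, (0 < r i)%N, forall i i', (i < i')%N -> (r i < r i')%N &
         forall s i, m (- (r i)%:Z - (n s)%:Z) <= m (- (r i)%:Z)] &
      forall s, m (- (n s)%:Z) <= s.+1%:R^-1].
Proof.
move=> eta0.
have /choice[q hq] (tL : nat * nat) :
    exists nr, stage (eta tL.1) tL.1 tL.2 nr.1 nr.2 by exact: stage_exists.
(* the next bound covers the block around n, of radius t, and the peak r *)
pose L := fix L t := if t is t'.+1 then
  ((q (t', L t')).1 + t' + (q (t', L t')).2)%N else 0%N.
pose n t := (q (t, L t)).1; pose r t := (q (t, L t)).2.
have LS t : L t.+1 = (n t + t + r t)%N by [].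
have hs t : stage (eta t) t (L t) (n t) (r t) by exact: hq (t, L t).
have Lmono s t : (s <= t)%N -> (L s <= L t)%N.
  elim: t => [|t IH] st; first by rewrite (_ : s = 0%N)//; lia.
  move: st; rewrite leq_eqVlt => /predU1P[->//|/IH sL].
  by rewrite LS; have [? _ _ _ _] := hs t; lia.
have nsL s t : (s < t)%N -> (n s + s + r s <= L t)%N.
  by move=> st; have := Lmono _ _ st; rewrite LS.
exists n, r; split.
- split=> [t|s t st]; have [? _ _ _ _] := hs t; first lia.
  by have := nsL _ _ st; lia.
- move=> t j jt; have [_ h _ _ _] := hs t; split; first by apply: h; lia.
  move=> s /nsL st; rewrite addrAC; apply: h; lia.
- move=> s t j /nsL ts jt; have [_ _ h _ _] := hs s; apply: h; lia.
- split.
  + by move=> i; have [_ _ _ _ []] := hs i; lia.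
  + by move=> i i' /nsL ii'; have [_ _ _ _ []] := hs i'; lia.
  + move=> s i; have [si|is_] := leqP s i.
      have [_ _ _ _ [_ h]] := hs i; apply: h.
      move: si; rewrite leq_eqVlt => /predU1P[->//|/nsL si].
      by have [? _ _ _ _] := hs i; lia.
    have /nsL is' := is_; have [_ _ h _ _] := hs s; apply: h; lia.
- by move=> s; have [_ _ _ h _] := hs s.
Qed.
End weights.

Local Open Scope classical_set_scope.
Local Open Scope complex_scope.
Local Open Scope quotient_scope.

(** * The tower of levels of a bijection with a wandering set *)

Section integral_le_on.
Import HBNNSimple.
Local Open Scope ereal_scope.
Context {d} {T : measurableType d} {R : realType}.
Variables m1 m2 : {measure set T -> \bar R}.
Variable D : set T.
Hypothesis mD : measurable D.
Hypothesis m12 : forall S, measurable S -> S `<=` D -> m1 S <= m2 S.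

(** A simple function below f restricted to D has its nonzero level sets inside D,
    so a comparison of the measures of the subsets of D is enough. *)
Lemma ge0_le_measure_integral_on (f : T -> \bar R) :
  (forall x, 0 <= f x) -> measurable_fun [set: T] f ->
  \int[m1]_(x in D) f x <= \int[m2]_(x in D) f x.
Proof.
move=> f0 mf; rewrite !ge0_integralE //= ge_ereal_sup// => _ [h/= hfS] <-.
apply: le_ereal_sup_tmp; exists (sintegral m2 h); first by exists h.
rewrite !sintegralE; apply: lee_fsum => // r.
have [->|r0] := eqVneq r 0%R; first by rewrite !mul0e.
have hD : h @^-1` [set r] `<=` D.
  move=> x /= hx; apply/not_notP => Dx.
  have := hfS x; rewrite hx /patch memNset// lee_fin => r_le0.
  have : (0 <= h x)%R by []. 
  by rewrite hx => r_ge0; move/eqP: r0; apply; apply/eqP; rewrite eq_le r_le0.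
case=> x _ hx; apply: lee_wpmul2l; last exact: m12.
by rewrite -hx lee_fin.
Qed.
End integral_le_on.

Section integer_iterates.
Context d (T : measurableType d) (f g : T -> T).
Hypotheses (fK : cancel f g) (gK : cancel g f).

Definition int_iter (n : int) : T -> T :=
  match n with Posz n => iter n f | Negz n => iter n.+1 g end.

Lemma int_iter_succ n z : int_iter (n + 1) z = f (int_iter n z).
Proof.
case: n => [n|[|n]].
- by rewrite (_ : Posz n + 1 = Posz n.+1)//; lia.
- by rewrite /= gK.
- by rewrite (_ : Negz n.+1 + 1 = Negz n); [rewrite /= gK|lia].
Qed.

Lemma int_iter_pred n z : int_iter (n - 1) z = g (int_iter n z).
Proof. by rewrite -{2}(subrK 1 n) int_iter_succ fK. Qed.

Lemma int_iterD m n z : int_iter (m + n) z = int_iter m (int_iter n z).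
Proof.
elim/int_ind: m => [|m IH|m IH]; first by rewrite add0r.
- rewrite (_ : m.+1%:Z + n = m%:Z + n + 1); last lia.
  by rewrite int_iter_succ IH -int_iter_succ (_ : m%:Z + 1 = m.+1)//; lia.
- rewrite (_ : - m.+1%:Z + n = - m%:Z + n - 1); last lia.
  by rewrite int_iter_pred IH -int_iter_pred (_ : - m%:Z - 1 = - m.+1%:Z)//; lia.
Qed.

(** Images under f^k are preimages under f^(- k): in this form the index k and its
    sign need no case distinction. *)
Lemma iter_imageE k B : iter_image f k B = int_iter (- k) @^-1` B.
Proof.
case: k => n; last by rewrite /iter_image (_ : - Negz n = n.+1)//; lia.
rewrite /iter_image; apply/seteqP; split => z.
  by move=> [y By <-] /=; rewrite -[iter n f y]/(int_iter n y) -int_iterD addNr.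
by move=> Bz; exists (int_iter (- n%:Z) z) => //;
  rewrite -[iter n f _]/(int_iter n _) -int_iterD subrr.
Qed.
End integer_iterates.

Section towers.
Context d (T : measurableType d) (f g : T -> T).
Hypotheses (fK : cancel f g) (gK : cancel g f).

(** The levels partition the space, so a point is described by the index kappa of
    its level, and applying f^n adds n to that index. *)
Lemma tower (W : set T) :
  trivIset setT (iter_image f ^~ W) -> \bigcup_k iter_image f k W = setT ->
  exists kappa : T -> int, (forall k, kappa @^-1` [set k] = iter_image f k W) /\
    forall n z, kappa (int_iter f g n z) = kappa z + n.
Proof.
move=> tW cW.
have /choice[kappa hk] z : exists k, iter_image f k W z.
  by have : [set: T] z by []; rewrite -cW => -[k _ ?]; exists k.
have kE k z : iter_image f k W z -> kappa z = k.
  by move=> kz; apply: (tW) => //; exists z; split.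
exists kappa; split.
  move=> k; apply/seteqP; split => z /=; last exact: kE.
  by move=> <-; exact: hk.
move=> n z; apply: kE; rewrite (iter_imageE fK gK) /= -(int_iterD fK gK).
by have := hk z; rewrite (iter_imageE fK gK) /= (_ : - (kappa z + n) + n = - kappa z)//; lia.
Qed.
End towers.

(** * Integrals along the tower *)

Section levels.
Context {d} {T : measurableType d} {R : realType}.
Variable kappa : T -> int.
Hypothesis mkappa : forall k, measurable (kappa @^-1` [set k]).

(** Countably many measurable pieces are glued along the levels of kappa. *)
Lemma measurable_pieces d' (U : measurableType d') (u : int -> T -> U) :
  (forall k, measurable_fun setT (u k)) ->
  measurable_fun setT (fun z => u (kappa z) z).
Proof.
move=> mu_ _ B mB; rewrite setTI.
rewrite (_ : _ @^-1` B =
    \bigcup_(k : int) (kappa @^-1` [set k] `&` (u k @^-1` B))).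
  apply: countable_bigcupT_measurable; first exact: countableP.
  move=> k; apply: measurableI => //; rewrite -[X in measurable X]setTI.
  exact: mu_.
apply/seteqP; split => z /=; first by move=> Bz; exists (kappa z).
by move=> [k _ [/= <-]].
Qed.

Lemma measurable_level (P : set int) : measurable (kappa @^-1` P).
Proof.
have : measurable_fun setT (fun z => `[< P (kappa z) >]).
  by apply: (@measurable_pieces _ _ (fun k _ => `[< P k >])) => k; exact: measurable_cst.
move=> /(_ measurableT [set true]); rewrite setTI => /(_ ltac:(by [])).
rewrite (_ : _ @^-1` _ = kappa @^-1` P)//.
by apply/seteqP; split => z /=; [move/asboolP|move=> ?; exact/asboolP].
Qed.

Lemma measurable_level_fun (u : int -> R) : measurable_fun setT (u \o kappa).
Proof. by apply: (@measurable_pieces _ _ (fun k _ => u k)) => k; exact: measurable_cst. Qed.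

(** The levels are enumerated by the codes of the integers; a nat that codes no
    integer contributes the empty set. *)
Lemma ge0_integral_levels (mu : {measure set T -> \bar R}) (g : T -> \bar R) : (forall z, 0 <= g z)%E ->
  measurable_fun setT g ->
  (\int[mu]_z g z =
   \sum_(0 <= j <oo) \int[mu]_(z in kappa @^-1` [set k | pickle k = j]) g z)%E.
Proof.
move=> g0 mg; rewrite -ge0_integral_bigcup.
- congr integral; apply/seteqP; split => // z _; by exists (pickle (kappa z)).
- by move=> j; exact: measurable_level.
- exact: measurable_funTS.
- by move=> z _; exact: g0.
- by move=> i j _ _ [z [/= <- <-]].
Qed.

Variable mu : {measure set T -> \bar R}.
Variables (F : int -> T -> T) (m : int -> R) (C : R).
Hypothesis mF : forall n, measurable_fun setT (F n).
Hypothesis m_gt0 : forall k, 0 < m k.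
Hypothesis C_ge0 : 0 <= C.
Hypothesis distort : forall n k B, measurable B -> B `<=` kappa @^-1` [set k] ->
  (mu (F n @^-1` B) <= (C * (m (k - n) / m k))%:E * mu B)%E.

Definition flow_density (n k : int) : R := m (k - n) / m k.

Lemma flow_density_ge0 n k : 0 <= flow_density n k.
Proof. by rewrite divr_ge0// ltW. Qed.

Lemma measurable_flow_density n :
  measurable_fun setT (fun z => (flow_density n (kappa z))%:E).
Proof.
by apply/measurable_EFinP; exact: (@measurable_level_fun (flow_density n)).
Qed.

(** On a single level the image measure of mu under F n is at most a constant
    multiple of mu; the levels are then summed. *)
Lemma integral_flow n (g : T -> \bar R) : (forall z, 0 <= g z)%E ->
  measurable_fun setT g ->
  (\int[mu]_z g (F n z) <=
   C%:E * \int[mu]_z ((flow_density n (kappa z))%:E * g z))%E.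
Proof.
move=> g0 mg.
have mw := measurable_flow_density n.
have w0 z : (0 <= (flow_density n (kappa z))%:E)%E.
  by rewrite lee_fin flow_density_ge0.
pose F' : {mfun T >-> T} := mfun_Sub (mem_set (@mF n)).
rewrite -ge0_integralZl_EFin//; last 2 first.
- by move=> z _; rewrite mule_ge0.
- exact: emeasurable_funM.
have -> : (\int[mu]_z g (F n z) = \int[pushforward mu F']_z g z)%E.
  by rewrite ge0_integral_pushforward// preimage_setT.
rewrite [leRHS]ge0_integral_levels; last 2 first.
- by move=> z; rewrite !mule_ge0.
- by apply: emeasurable_funM => //; exact: emeasurable_funM.
have mlev j : measurable (kappa @^-1` [set k | pickle k = j]).
  exact: measurable_level.
rewrite [leLHS]ge0_integral_levels//.
apply: lee_nneseries => [j _ _|j _].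
  by apply: integral_ge0 => z _; exact: g0.
have [[k kj]|nk] := pselect (exists k : int, pickle k = j); last first.
  rewrite (_ : kappa @^-1` _ = set0) ?integral_set0//.
  by apply/seteqP; split => // z /= zj; apply: nk; exists (kappa z).
have -> : kappa @^-1` [set k | pickle k = j] = kappa @^-1` [set k].
  by apply/seteqP; split => z /=; [rewrite -kj => /(pcan_inj pickleK)|move=> ->].
have ck0 : 0 <= C * (m (k - n) / m k) by rewrite mulr_ge0// (flow_density_ge0 n k).
have -> : (\int[mu]_(z in kappa @^-1` [set k])
    (C%:E * ((flow_density n (kappa z))%:E * g z)) =
    \int[mscale (NngNum ck0) mu]_(z in kappa @^-1` [set k]) g z)%E.
  rewrite ge0_integral_mscale//; last exact: measurable_funTS.
  rewrite -ge0_integralZl_EFin//; last exact: measurable_funTS.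
  by apply: eq_integral => z; rewrite inE => /= ->; rewrite muleA EFinM.
apply: ge0_le_measure_integral_on => // S mS Sk; exact: distort.
Qed.

End levels.

(** * The norm of the complex L^p space and p-th power masses *)

Section complex_normed.
Variables (R : realType) (Y : normedModType R[i]).

Lemma complex_gt0P (e : R[i]) : 0 < e -> exists2 r : R, 0 < r & e = r%:C.
Proof.
by case: e => a b; rewrite ltcE/= => /andP[/eqP-> a0]; exists a.
Qed.

(** Radii of balls are complex numbers here; only positive real ones matter. *)
Lemma dense_normP (S : set Y) : dense S <->
  forall (y : Y) (e : R), 0 < e -> exists2 s, S s & `|y - s| < e%:C.
Proof.
split=> [dS y e e0|h O [y Oy] oO].
  have eC0 : 0 < e%:C by rewrite ltcR.
  have [|s [ys Ss]] := dS (ball y e%:C) _ (ball_open _ _).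
    by exists y; exact: ballxx.
  by exists s => //; move: ys; rewrite -ball_normE.
have /nbhs_ballP[e /= /complex_gt0P[r r0 ->] rO] := open_nbhs_nbhs (conj oO Oy).
have [s Ss ys] := h y r r0.
by exists s; split => //; apply: rO; rewrite -ball_normE.
Qed.

Lemma closed_norm (V : set Y) :
  (forall y, (forall e : R, 0 < e -> exists2 s, V s & `|y - s| < e%:C) -> V y) ->
  closed V.
Proof.
move=> h y cy; apply: h => e e0.
have eC0 : 0 < e%:C by rewrite ltcR.
have [s [Vs ys]] := cy _ (nbhsx_ballx y _ eC0).
by exists s => //; move: ys; rewrite -ball_normE.
Qed.

End complex_normed.

Section pth_power_integral.
Context {d} {T : measurableType d} {R : realType}.
Variables (mu : {measure set T -> \bar R}) (p : R).
Hypothesis p1 : 1 <= p.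
Let p0 : 0 < p. Proof. exact: lt_le_trans p1. Qed.
Implicit Types g : T -> R[i].

(** The p-th power of the norm of L^p; it is additive over disjoint sets, which
    the norm is not. *)
Definition pmass g : \bar R := (\int[mu]_x (normc (g x) `^ p)%:E)%E.

Lemma pmass_ge0 g : (0 <= pmass g)%E.
Proof. by apply: integral_ge0 => x _; rewrite lee_fin powR_ge0. Qed.

Lemma le_pmass g h : cmeasurable g -> cmeasurable h ->
  (forall x, normc (g x) <= normc (h x)) -> (pmass g <= pmass h)%E.
Proof.
move=> mg mh gh; apply: ge0_le_integral => //.
- by move=> x _; rewrite lee_fin powR_ge0.
- exact: measurable_normc_powR.
- exact: measurable_normc_powR.
- by move=> x _; rewrite lee_fin ge0_ler_powR ?(ltW p0) ?nnegrE ?normc_ge0.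
Qed.

Lemma cLnorm_lt g (e : R) : 0 < e ->
  (cLnorm mu p g < e%:E)%E = (pmass g < (e `^ p)%:E)%E.
Proof.
move=> e0; rewrite cLnorm_integral -/(pmass g).
have := pmass_ge0 g; case: (pmass g) => [r| |//] r0.
  have r0' : 0 <= r by rewrite -lee_fin.
  rewrite poweR_EFin !lte_fin.
  rewrite -[e in LHS]powRr1 ?(ltW e0)// -[X in e `^ X](mulfV (lt0r_neq0 p0)) powRrM.
  have ip0 : 0 < p^-1 by rewrite invr_gt0.
  apply/idP/idP => h; last by apply: gt0_ltr_powR; rewrite ?nnegrE ?powR_ge0.
  rewrite ltNge; apply/negP => /(ge0_ler_powR (ltW ip0)).
  by rewrite ?nnegrE ?powR_ge0// => /(_ isT r0'); rewrite leNgt h.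
by rewrite poweRyr ?invr_neq0 ?lt0r_neq0.
Qed.

Lemma cLnorm_fin g : (cLnorm mu p g < +oo)%E = (pmass g < +oo)%E.
Proof.
rewrite cLnorm_integral -/(pmass g).
have := pmass_ge0 g; case: (pmass g) => [r| |//] r0.
  by rewrite poweR_EFin !ltey.
by rewrite poweRyr ?invr_neq0 ?lt0r_neq0.
Qed.

Lemma cLfun_pmass g : g \in cLfun mu p <-> cmeasurable g /\ (pmass g < +oo)%E.
Proof. by split; [move/cLfunP|move=> ?; apply/cLfunP]; rewrite -?cLnorm_fin// cLnorm_fin. Qed.

Lemma norm_pi_lt (g : cLfunType mu p1) (e : R) : 0 < e ->
  (`|\pi_(cLspace mu p1) g| < e%:C) = (pmass g < (e `^ p)%:E)%E.
Proof.
by move=> e0; rewrite cLspace_normE ltcR -lte_fin cLfun_fineK cLnorm_lt.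
Qed.

Lemma cLpiB (g h : cLfunType mu p1) :
  \pi_(cLspace mu p1) (g - h) = \pi_(cLspace mu p1) g - \pi_(cLspace mu p1) h.
Proof. by rewrite cLpiD -scaleN1r cLpiZ scaleN1r. Qed.

End pth_power_integral.

(** * Towers of bounded distortion *)

Section iterates.
Context {d} {T : measurableType d} {R : realType}.
Variables (mu : {measure set T -> \bar R}) (p : R) (p1 : 1 <= p).
Variables (f : T -> T) (hf : composition_map mu f).

Lemma iter_cLfun_compE n (g : cLfunType mu p1) x :
  iter n (cLfun_comp hf) g x = g (iter n f x).
Proof. by elim: n x => // n IH x; rewrite [in RHS]iterSr -IH. Qed.

Lemma iter_composition_op n (g : cLfunType mu p1) :
  iter n (composition_op p1 hf) (\pi_(cLspace mu p1) g) =
  \pi_(cLspace mu p1) (iter n (cLfun_comp hf) g).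
Proof. by elim: n => //= n ->; rewrite composition_op_pi. Qed.
End iterates.

(** Bounded distortion, freed from the wandering set: F n is f^n for n in Z, kappa
    the index of a level, m the weights of the levels.  Distortion is stated for
    preimages, which is the form that composition with F n calls for. *)
Record distorted_tower {d} {T : measurableType d} {R : realType}
    (mu : {measure set T -> \bar R}) (f : T -> T) (F : int -> T -> T)
    (kappa : T -> int) (m : int -> R) (C : R) : Prop := DistortedTower {
  tower_iter : forall (n : nat) x, F n x = iter n f x ;
  tower_iterD : forall k l x, F (k + l) x = F k (F l x) ;
  tower_measurable : forall n, measurable_fun setT (F n) ;
  tower_level : forall k, measurable (kappa @^-1` [set k]) ;
  tower_shift : forall n x, kappa (F n x) = kappa x + n ;
  tower_mass : forall k, mu (kappa @^-1` [set k]) = (m k)%:E ;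
  tower_mass_gt0 : forall k, 0 < m k ;
  tower_const_ge0 : 0 <= C ;
  tower_distortion : forall n k B, measurable B ->
    B `<=` kappa @^-1` [set k] ->
    (mu (F n @^-1` B) <= (C * (m (k - n) / m k))%:E * mu B)%E }.

Section tower_existence.
Context {d} {T : measurableType d} {R : realType}.
Variables (mu : {measure set T -> \bar R}) (f : T -> T).
Hypothesis hf : composition_map mu f.

(** Distortion between two levels compares each with W, which costs the distortion
    constant twice: C is K * K.  The boundedness of the operator and of its inverse
    makes consecutive weights comparable, hence positive and finite. *)
Lemma tower_of_bounded_distortion : dissipative_bounded_distortion mu f ->
  exists F kappa m C, distorted_tower mu f F kappa m C /\
    exists2 c, 1 <= c & forall k, m (k + 1) <= c * m k /\ m (k - 1) <= c * m k.
Proof.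
move=> [W [[mW tW] /andP[W0 Woo] cW] [K K0 hK]].
have [g fK gK] := composition_map_bij hf.
have [c c0 hc] := composition_map_bound hf.
have [kappa [kE kF]] := tower fK gK tW cW.
pose F := int_iter f g.
have FD k l x : F (k + l) x = F k (F l x) by exact: int_iterD.
have F0 x : F 0 x = x by [].
have mf : measurable_fun setT f := composition_map_measurable hf.
have gE (B : set T) : g @^-1` B = f @` B.
  apply/seteqP; split => x /=; first by move=> Bx; exists (g x).
  by move=> [y By <-]; rewrite fK.
have mg : measurable_fun setT g.
  by move=> _ B mB; rewrite setTI gE; exact: composition_map_im hf _ mB.
have mF n : measurable_fun setT (F n).
  have it (h : T -> T) k : measurable_fun setT h -> measurable_fun setT (iter k h).
    move=> mh; elim: k => [|k IH]; first exact: measurable_id.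
    exact: (measurableT_comp mh IH).
  by case: n => n; exact: it.
have kE' k : kappa @^-1` [set k] = F (- k) @^-1` W.
  by rewrite kE (iter_imageE fK gK).
have mE k : measurable (kappa @^-1` [set k]).
  by rewrite kE' -[X in measurable X]setTI; exact: mF.
pose M k := mu (kappa @^-1` [set k]).
have MS k : (M (k + 1)%R <= c%:E * M k)%E.
  have [_] := hc _ (mE k).
  suff -> : f @` (kappa @^-1` [set k]) = kappa @^-1` [set (k + 1)] by [].
  rewrite -gE; apply/seteqP; split => x /=; rewrite -[g x]/(F (-1) x) kF; lia.
have MP k : (M (k - 1)%R <= c%:E * M k)%E.
  have [+ _] := hc _ (mE k).
  suff -> : f @^-1` (kappa @^-1` [set k]) = kappa @^-1` [set (k - 1)] by [].
  apply/seteqP; split => x /=; rewrite -[f x]/(F 1 x) kF; lia.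
have M0 : M 0 = mu W by rewrite /M kE' oppr0.
have Moo k : (M k < +oo)%E.
  elim/int_ind: k => [|k IH|k IH]; first by rewrite M0.
    rewrite (_ : k.+1%:Z = k%:Z + 1); last lia.
    by apply: le_lt_trans (MS _) _; rewrite lte_mul_pinfty ?lee_fin// ltW.
  rewrite (_ : - k.+1%:Z = - k%:Z - 1); last lia.
  by apply: le_lt_trans (MP _) _; rewrite lte_mul_pinfty ?lee_fin// ltW.
have Mpos k : (0 < M k)%E.
  have h a b : (0 < a)%E -> (a <= c%:E * b)%E -> (0 <= b)%E -> (0 < b)%E.
    move=> a0 ab b0; rewrite lt_neqAle b0 andbT; apply/eqP => b_eq.
    by move: (lt_le_trans a0 ab); rewrite -b_eq mule0 ltxx.
  elim/int_ind: k => [|k IH|k IH]; first by rewrite M0.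
    apply: h IH _ (measure_ge0 _ _).
    by have := MP k.+1%:Z; rewrite (_ : k.+1%:Z - 1 = k%:Z)//; lia.
  apply: h IH _ (measure_ge0 _ _).
  by have := MS (- k.+1%:Z); rewrite (_ : - k.+1%:Z + 1 = - k%:Z)//; lia.
pose m k := fine (M k).
have mM k : M k = (m k)%:E.
  by rewrite /m fineK// ge0_fin_numE// ?ltW.
have m0 k : 0 < m k by rewrite -lte_fin -mM.
exists F, kappa, m, (K * K); split; last first.
  exists (Num.max 1 c); first by rewrite le_max lexx.
  have hc' k : c * m k <= Num.max 1 c * m k.
    by rewrite ler_wpM2r ?le_max ?lexx ?orbT// ltW.
  move=> k; split; (apply: le_trans (hc' k));
    by rewrite -lee_fin EFinM -!mM.
split => //.
- by rewrite mulr_ge0// ltW.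
- move=> n k B mB Bk.
  pose B' := F k @^-1` B.
  have mB' : measurable B' by rewrite -[X in measurable X]setTI; exact: mF.
  have B'W : B' `<=` W.
    move=> x /Bk; rewrite kE' /= -FD addNr F0 //.
  have eB : iter_image f k B' = B.
    rewrite (iter_imageE fK gK) -[int_iter f g]/F.
    by apply/seteqP; split => x; rewrite /B' /= -FD subrr F0.
  have eBn : iter_image f (k - n) B' = F n @^-1` B.
    rewrite (iter_imageE fK gK) -[int_iter f g]/F.
    by apply/seteqP; split => x; rewrite /B' /= -FD (_ : k + - (k - n) = n)//; lia.
  have [+ _] := hK k B' mB' B'W; have [_] := hK (k - n) B' mB' B'W.
  rewrite -!kE -/(M _) -/(M _) eB eBn -M0 !mM.
  have fin (A : set T) k' : measurable A -> A `<=` kappa @^-1` [set k'] ->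
      mu A = (fine (mu A))%:E.
    move=> mA Ak; rewrite fineK// ge0_fin_numE//.
    by apply: le_lt_trans (Moo k'); apply: le_measure => //; rewrite inE.
  rewrite (fin B k)// (fin B' 0)//; last by rewrite kE' oppr0.
  rewrite (fin (F n @^-1` B) (k - n)); last 2 first.
  - by rewrite -[X in measurable X]setTI; exact: mF.
  - by move=> x /Bk /=; rewrite kF; lia.
  set a := fine _; set b := fine _; set b' := fine _.
  rewrite -!EFinM !lee_fin => h1 h2.
  rewrite -(ler_pM2r (m0 0)); apply: (le_trans h1).
  have -> : K * K * (m (k - n) / m k) * b' * m 0 =
    K * m (k - n) * (K * (b' * m 0) / m k) by ring.
  rewrite [leLHS]mulrA; apply: ler_wpM2l.
    by rewrite mulr_ge0// ltW.
  rewrite ler_pdivlMr// mulrC -ler_pdivrMl//; exact: h2.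
Qed.
End tower_existence.

(** * Hypercyclicity makes the weights small on both sides *)

Section complex_norm.
Variable R : realType.
Implicit Types x y : R[i].

Lemma normcD_le x y : normc (x + y) <= normc x + normc y.
Proof. exact: le_normcD. Qed.

Lemma normc_opp x : normc (- x) = normc x.
Proof. exact: normcN. Qed.

Lemma normc_real (a : R) : normc a%:C = `|a|.
Proof. by rewrite /= expr0n addr0 sqrtr_sqr. Qed.
End complex_norm.

Section hypercyclic_small.
Context {d} {T : measurableType d} {R : realType}.
Variables (mu : {measure set T -> \bar R}) (p : R) (p1 : 1 <= p).
Let p0 : 0 < p. Proof. exact: lt_le_trans p1. Qed.

(** The threshold 1/2 separates values near 0 from values near a real number
    at least 1. *)
Definition far (g : T -> R[i]) : set T := [set z | 2^-1 <= normc (g z)].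

Lemma measurable_far g : cmeasurable g -> measurable (far g).
Proof.
move=> mg; have := measurable_normc mg.
move=> /(_ measurableT `[2^-1, +oo[%classic (measurable_itv _)); rewrite setTI.
by congr measurable; apply/seteqP; split => z /=; rewrite in_itv/= andbT.
Qed.

(** Markov's inequality for the p-th power. *)
Lemma measure_far g : cmeasurable g -> (mu (far g) <= (2 `^ p)%:E * pmass mu p g)%E.
Proof.
move=> mg; have mfar := measurable_far mg.
rewrite -[X in mu X]setIT -integral_indic// -ge0_integralZl_EFin ?powR_ge0//.
- apply: ge0_le_integral => //.
  + by apply/measurable_EFinP; exact: measurable_indic.
  + apply: emeasurable_funM => //; exact: measurable_normc_powR.
  + move=> z _; rewrite -EFinM lee_fin indicE.
    have [|_] := boolP (z \in far g); last by rewrite mulr_ge0 ?powR_ge0.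
    rewrite inE /far /= => zf; rewrite -powRM ?normc_ge0//.
    have e1 : 1 `^ p = 1 :> R by rewrite powR1.
    rewrite -[X in X <= _]e1 ge0_ler_powR ?(ltW p0) ?nnegrE ?mulr_ge0 ?normc_ge0//.
    by rewrite mulrC -ler_pdivrMr// mul1r.
- by move=> z _; rewrite lee_fin powR_ge0.
- exact: measurable_normc_powR.
Qed.

Variables (f : T -> T) (hf : composition_map mu f).
Variables (F : int -> T -> T) (kappa : T -> int) (m : int -> R) (C : R).
Hypothesis tower : distorted_tower mu f F kappa m C.

Definition level_indicator (a : R) (z : T) : R[i] := if kappa z == 0 then a%:C else 0.

Lemma cmeasurable_levels (u : int -> R[i]) : cmeasurable (fun z => u (kappa z)).
Proof.
split; apply: (measurable_pieces (tower_level tower)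
  (u := fun k _ => _ (u k))) => k; exact: measurable_cst.
Qed.

Lemma level_indicator_cLfun a : level_indicator a \in cLfun mu p.
Proof.
apply/(cLfun_pmass _ p1).
have mE := tower_level tower 0.
split; first exact: (cmeasurable_levels (fun k => if k == 0 then a%:C else 0)).
rewrite /pmass (_ : (\int[mu]_x _)%E =
  (\int[mu]_x ((normc a%:C `^ p)%:E * (\1_(kappa @^-1` [set 0%R]) x)%:E))%E).
  rewrite ge0_integralZl_EFin ?powR_ge0//; last first.
    by apply/measurable_EFinP; exact: measurable_indic.
  by rewrite integral_indic// setIT (tower_mass tower) -EFinM ltry.
apply: eq_integral => z _; rewrite /level_indicator -EFinM indicE.
have [k0|k0] := eqVneq (kappa z) 0; first by rewrite mem_set// mulr1.
rewrite memNset; last by move/eqP: k0.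
by rewrite mulr0 normc0 powR0// lt0r_neq0.
Qed.

(** Let g1 be close to a constant a on level 0 and small elsewhere, and likewise
    g2 = g1 o F n.  Most points of level 0 have |g2| > 1/2 there; F n moves them to
    level n <> 0, where |g1| > 1/2 is exceptional.  So a subset of level 0 with at
    least half of its mass is carried to a set of mass at most q, and by
    distortion level n is itself small.  The sign of n is immaterial, so the
    roles of g1 and g2 can be exchanged. *)
Lemma near_translates_small (g1 g2 : T -> R[i]) (a b : R) (n : int) (q : R) :
  cmeasurable g2 -> 1 <= a -> 1 <= b -> n != 0 ->
  (forall z, g2 z = g1 (F n z)) ->
  measurable (far (g1 - level_indicator a)%R) ->
  (mu (far (g1 - level_indicator a)%R) <= q%:E)%E ->
  (mu (far (g2 - level_indicator b)%R) <= q%:E)%E ->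
  q <= m 0 / 4 -> m n <= 2 * C * q.
Proof.
move=> mg2 a1 b1 n0 g12 mfar1 far1 far2 q0.
set E0 := kappa @^-1` [set 0].
have mE0 : measurable E0 := tower_level tower 0.
have mfar2 : measurable (far (g2 - level_indicator b)%R).
  apply: measurable_far; rewrite -scaleN1r; apply: cmeasurableD => //.
  apply: cmeasurableZ; exact: (cmeasurable_levels (fun k => if k == 0 then b%:C else 0)).
pose B := E0 `\` far (g2 - level_indicator b)%R.
have mB : measurable B by exact: measurableD.
have half (x : R) (z : R[i]) : 1 <= x -> normc (z - x%:C) < 2^-1 -> 2^-1 <= normc z.
  move=> x1 zx.
  have : normc x%:C <= normc z + normc (z - x%:C).
    rewrite -[X in normc X <= _](subKr z).
    by apply: le_trans (normcD_le _ _) _; rewrite normc_opp.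
  rewrite normc_real ger0_norm; last exact: le_trans x1.
  lra.
have BF : F (- n) @^-1` B `<=` far (g1 - level_indicator a)%R.
  move=> y [/= Ey /negP]; rewrite -ltNge => hy.
  have ky : kappa y = n.
    by apply/eqP; move/eqP: Ey; rewrite (tower_shift tower) subr_eq0.
  have Fy : F n (F (- n) y) = y.
    by rewrite -(tower_iterD tower) subrr (tower_iter tower 0).
  have g2y : g2 (F (- n) y) = g1 y by rewrite g12 Fy.
  rewrite /far /= (_ : (g1 - level_indicator a) y = g1 y); last first.
    change (g1 y - level_indicator a y = g1 y).
    by rewrite /level_indicator ky (negbTE n0) subr0.
  rewrite -g2y; apply: half b1 _.
  move: hy; rewrite (_ : (g2 - level_indicator b) (F (- n) y) = g2 (F (- n) y) - b%:C)//.
  change (g2 (F (- n) y) - level_indicator b (F (- n) y) = g2 (F (- n) y) - b%:C).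
  by rewrite /level_indicator (tower_shift tower) ky subrr eqxx.
have FB : (mu (F (- n) @^-1` B) <= q%:E)%E.
  apply: le_trans far1; apply: le_measure => //; rewrite inE//.
  by rewrite -[X in measurable X]setTI; exact: (tower_measurable tower).
have mF_B : measurable (F (- n) @^-1` B).
  by rewrite -[X in measurable X]setTI; exact: (tower_measurable tower).
have m00 := tower_mass_gt0 tower 0.
have Bfin : mu B = (fine (mu B))%:E.
  rewrite fineK// ge0_fin_numE//; apply: (@le_lt_trans _ _ (mu E0)).
    by apply: le_measure; rewrite ?inE// => z [].
  by rewrite (tower_mass tower) ltry.
have muB : (m 0 / 2 <= fine (mu B)).
  have : (mu E0 <= mu B + mu (far (g2 - level_indicator b)%R))%E.
    apply: le_trans (measureU2 _ _ _) => //; apply: le_measure; rewrite ?inE//.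
      exact: measurableU.
    by move=> z Ez; have [?|?] := pselect (far (g2 - level_indicator b)%R z);
      [right|left].
  rewrite (tower_mass tower) Bfin => /le_trans /(_ (leeD2l _ far2)).
  rewrite -EFinD lee_fin; lra.
have := tower_distortion tower n mF_B.
rewrite (_ : F n @^-1` _ = B); last first.
  apply/seteqP; split => z;
  by rewrite /= -(tower_iterD tower) addNr (tower_iter tower 0).
move=> /(_ n); have Bn : F (- n) @^-1` B `<=` kappa @^-1` [set n].
  by move=> z [/eqP + _]; rewrite (tower_shift tower) subr_eq0 => /eqP.
move=> /(_ Bn); rewrite subrr Bfin.
have mn0 := tower_mass_gt0 tower n.
have C0 := tower_const_ge0 tower.
have CC : 0 <= C * (m 0 / m n) by rewrite mulr_ge0// divr_ge0// ltW.
move=> /le_trans /(_ (lee_wpmul2l _ FB)).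
rewrite -EFinM !lee_fin => /(_ CC) h.
have : m 0 / 2 <= C * (m 0 / m n) * q by exact: le_trans muB h.
rewrite (_ : C * (m 0 / m n) * q = (C * m 0 * q) / m n); last by ring.
rewrite ler_pdivlMr// => h'.
rewrite -(ler_pM2l m00); lra.
Qed.

(** The orbit of a hypercyclic vector comes close to the indicator of level 0 and
    to three times this indicator.  The two targets are far apart, so they are
    approached at different times, and the difference of these times makes both
    weights small. *)
Lemma hypercyclic_small : hypercyclic (composition_op p1 hf) ->
  forall e, 0 < e -> exists n : nat, m n%:Z < e /\ m (- n%:Z) < e.
Proof.
move=> [h0]; elim/cLspaceW: h0 => h /dense_normP hd e e0.
have m00 := tower_mass_gt0 tower 0.
have C0 := tower_const_ge0 tower.
(* q <= m 0 / 4 lets half of level 0 survive; the other bound gives 2 C q < e *)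
pose q := Num.min (m 0 / 4) (e / (4 * (C + 1))).
have q0 : 0 < q by rewrite lt_min !divr_gt0// mulr_gt0//; lra.
pose q' := q / (2 `^ p).
have q'0 : 0 < q' by rewrite divr_gt0// powR_gt0.
pose de := q' `^ p^-1.
have de0 : 0 < de by rewrite powR_gt0.
have deE : de `^ p = q' by rewrite -powRrM mulVf ?powRr1 ?ltW// lt0r_neq0.
pose ind a := CLfun p1 (level_indicator_cLfun a).
have hg (n : nat) z : iter n (cLfun_comp hf) h z = h (F n z).
  by rewrite iter_cLfun_compE (tower_iter tower).
have near a : exists n : nat,
    (mu (far ((fun z => h (F n z)) - level_indicator a)%R) <= q%:E)%E.
  have [_ [n _ <-]] := hd (\pi_(cLspace mu p1) (ind a)) _ de0.
  rewrite iter_composition_op distrC -cLpiB norm_pi_lt// deE => hlt.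
  exists n; set G := _ - _; have -> : G = (iter n (cLfun_comp hf) h - ind a : cLfunType mu p1).
    apply/funext => z; change (h (F n z) - level_indicator a z =
      iter n (cLfun_comp hf) h z - level_indicator a z).
    by rewrite hg.
  apply: le_trans (measure_far _) _; first exact: cLfun_measurable.
  have -> : q = 2 `^ p * q' by rewrite /q' mulrC divfK// gt_eqF// powR_gt0.
  by rewrite EFinM; apply: lee_wpmul2l; [rewrite lee_fin powR_ge0|exact: ltW].
have [a ha] := near 1; have [b hb] := near 3.
have mg n : cmeasurable (fun z => h (F n z)).
  have [h1 h2] := cLfun_measurable h.
  by split; [exact: (measurableT_comp h1 (tower_measurable tower n))|
    exact: (measurableT_comp h2 (tower_measurable tower n))].
have mf (n : nat) c : measurable (far ((fun z => h (F n z)) - level_indicator c)%R).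
  apply: measurable_far; rewrite -scaleN1r; apply: cmeasurableD => //.
  apply: cmeasurableZ; exact: (cmeasurable_levels (fun k => if k == 0 then c%:C else 0)).
have q1 : q <= m 0 / 4 by rewrite ge_min lexx.
have q2 : 2 * C * q < e.
  have : q <= e / (4 * (C + 1)) by rewrite ge_min lexx orbT.
  rewrite ler_pdivlMr; last lra.
  have : 0 <= C * q by rewrite mulr_ge0// ltW.
  lra.
(* equal times would cover level 0 by two sets of mass at most m 0 / 4 *)
have [ab|ab] := eqVneq a b.
  exfalso; move: hb; rewrite -ab => hb.
  set g := (fun z => h (F a z)) in ha hb.
  have : (mu (kappa @^-1` [set 0%R]) <= q%:E + q%:E)%E.
    apply: le_trans (leeD ha hb).
    apply: le_trans (measureU2 _ _ _); rewrite -?/g; last 2 first.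
    - exact: mf.
    - exact: mf.
    apply: le_measure; rewrite ?inE; first exact: (tower_level tower).
      by apply: measurableU; exact: mf.
    move=> z /= kz; apply: contrapT => /not_orP[/negP + /negP]; rewrite -!ltNge.
    rewrite (_ : (g - level_indicator 1) z = g z - level_indicator 1 z)//.
    rewrite (_ : (g - level_indicator 3) z = g z - level_indicator 3 z)//.
    rewrite /level_indicator kz eqxx.
    move=> h1 h2.
    have : normc (3%:C - 1%:C : R[i]) <= normc (g z - 1%:C) + normc (g z - 3%:C).
      rewrite (_ : 3%:C - 1%:C = (g z - 1%:C) - (g z - 3%:C)); last first.
        by ring.
      by apply: le_trans (normcD_le _ _) _; rewrite normc_opp.
    rewrite -rmorphB normc_real ger0_norm; last lra.
    lra.
  rewrite (tower_mass tower) -EFinD lee_fin; lra.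
have sub : b%:Z - a%:Z != 0 by rewrite subr_eq0 eqz_nat eq_sym.
have FF (k l : int) z : h (F l z) = h (F k (F (l - k) z)).
  by rewrite -(tower_iterD tower) addrCA subrr addr0.
have s1 : m (b%:Z - a%:Z) < e.
  apply: le_lt_trans q2.
  by apply: (near_translates_small (g1 := fun z => h (F a z)) (mg b) _ _ sub
    (FF _ _) (mf _ _) ha hb q1); lra.
have sub' : a%:Z - b%:Z != 0 by rewrite subr_eq0 eqz_nat.
have s2 : m (a%:Z - b%:Z) < e.
  apply: le_lt_trans q2.
  by apply: (near_translates_small (g1 := fun z => h (F b z)) (mg a) _ _ sub'
    (FF _ _) (mf _ _) hb ha q1); lra.
have [ba|/ltnW ba] := leqP a b.
  by exists (b - a)%N; rewrite -subzn// opprB.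
by exists (a - b)%N; rewrite -subzn// opprB.
Qed.
End hypercyclic_small.

(** * Spaces of multiples of a profile *)

Section complex_limit.
Variable R : realType.

Lemma complex_ge0E (z : R[i]) : 0 <= z -> z = (complex.Re z)%:C.
Proof. by case: z => a b; rewrite lecE/= => /andP[/eqP-> _]. Qed.

Lemma norm_eq0_of_small (Y : normedModType R[i]) (x : Y) (M : R) :
  (forall n : nat, `|x| <= (M / n.+1%:R)%:C) -> x = 0.
Proof.
move=> h; apply/eqP; rewrite -normr_le0 (complex_ge0E (normr_ge0 x)) lecR leNgt.
apply/negP => x0; pose k := Num.truncn (M / complex.Re `|x|).
have := h k; rewrite (complex_ge0E (normr_ge0 x)) lecR leNgt => /negP; apply.
by rewrite ltr_pdivrMr// mulrC -ltr_pdivrMr// /k truncnS_gt.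
Qed.

(** The supremum of the lower bounds u l - e l is within e n of each u n, so the
    limit comes with its rate and no filter is involved. *)
Lemma real_limit_of_errors (u e : nat -> R) :
  (forall n l, `|u n - u l| <= e n + e l) -> exists x, forall n, `|u n - x| <= e n.
Proof.
move=> h.
pose S := [set u l - e l | l in [set: nat]].
have ub n : ubound S (u n + e n).
  by move=> _ [l _ <-]; have := h n l; rewrite ler_norml; lra.
have hS : has_sup S by split; [exists (u 0%N - e 0%N), 0%N|exists (u 0%N + e 0%N)].
exists (sup S) => n; rewrite ler_norml; apply/andP; split.
  have : sup S <= u n + e n by apply: sup_le_ub; [case: hS|exact: ub].
  lra.
have : u n - e n <= sup S by apply: ub_le_sup; [case: hS|exists n].
lra.
Qed.

Lemma complex_limit_of_errors (u : nat -> R[i]) (e : nat -> R) :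
  (forall n l, normc (u n - u l) <= e n + e l) ->
  exists x, forall n, normc (u n - x) <= 2 * e n.
Proof.
move=> h.
have ReIm (z : R[i]) : [/\ `|complex.Re z| <= normc z, `|complex.Im z| <= normc z &
    normc z <= `|complex.Re z| + `|complex.Im z|].
  case: z => a b /=; split.
  - by rewrite -sqrtr_sqr ler_wsqrtr// lerDl sqr_ge0.
  - by rewrite -sqrtr_sqr ler_wsqrtr// lerDr sqr_ge0.
  - have ab0 : 0 <= `|a| + `|b| by rewrite addr_ge0.
    rewrite -[leRHS](ger0_norm ab0) -sqrtr_sqr ler_wsqrtr// sqrrD !real_normK ?num_real//.
    by have := mulr_ge0 (normr_ge0 a) (normr_ge0 b); lra.
have [x hx] := @real_limit_of_errors (fun n => complex.Re (u n)) e
  ltac:(move=> n l; have [+ _ _] := ReIm (u n - u l);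
        rewrite raddfB => /le_trans; apply; exact: h).
have [y hy] := @real_limit_of_errors (fun n => complex.Im (u n)) e
  ltac:(move=> n l; have [_ + _] := ReIm (u n - u l);
        rewrite raddfB => /le_trans; apply; exact: h).
exists (x +i* y) => n; have [_ _ /le_trans] := ReIm (u n - (x +i* y)); apply.
rewrite !raddfB/=; have := hx n; have := hy n; lra.
Qed.
End complex_limit.

Section blends.
Context {d} {T : measurableType d} {R : realType}.
Variables (j : T -> nat) (S : nat -> set T) (psi : T -> R[i]).
Hypothesis mj : forall i, measurable (j @^-1` [set i]).
Hypothesis mpsi : cmeasurable psi.

Definition fibre_cut (i : nat) (g : T -> R[i]) (z : T) : R[i] :=
  if j z == i then g z else 0.

Definition blend (a : nat -> R[i]) (z : T) : R[i] := a (j z) * psi z.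

Lemma cmeasurable_fibres (u : nat -> T -> R[i]) : (forall i, cmeasurable (u i)) ->
  cmeasurable (fun z => u (j z) z).
Proof.
move=> mu_; have mk k : measurable ((fun z => Posz (j z)) @^-1` [set k]).
  case: k => k.
    by rewrite (_ : _ @^-1` _ = j @^-1` [set k])//; apply/seteqP; split => z /=; lia.
  by rewrite (_ : _ @^-1` _ = set0)//; apply/seteqP; split => z /=; lia.
split.
- apply: (measurable_pieces mk (u := fun k z => complex.Re (u `|k|%N z))) => k.
  by have [] := mu_ `|k|%N.
- apply: (measurable_pieces mk (u := fun k z => complex.Im (u `|k|%N z))) => k.
  by have [] := mu_ `|k|%N.
Qed.

Lemma cmeasurable_blend a : cmeasurable (blend a).
Proof.
apply: (@cmeasurable_fibres (fun i z => a i * psi z)) => i.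
exact: (cmeasurableZ (a i) mpsi).
Qed.

Lemma cmeasurable_cut i g : cmeasurable g -> cmeasurable (fibre_cut i g).
Proof.
move=> mg; apply: (@cmeasurable_fibres (fun k z => if k == i then g z else 0)) => k.
by case: eqP => // _; exact: cmeasurable0.
Qed.

Variables (mu : {measure set T -> \bar R}) (p : R) (p1 : 1 <= p).
Let p0 : 0 < p. Proof. exact: lt_le_trans p1. Qed.
Local Notation ty := (cLfunType mu p1).
Local Notation Lp := (cLspace mu p1).

Hypothesis mS : forall i, measurable (S i).
Hypothesis Sj : forall i, S i `<=` j @^-1` [set i].
Hypothesis psiS : forall i, (\int[mu]_(z in S i) (normc (psi z) `^ p)%:E = 1)%E.
Hypothesis psi_fibre : forall i, fibre_cut i psi \in cLfun mu p.

(** On S i the function blend a is a i times psi, and psi has mass 1 there. *)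
Lemma coef_le_pmass a i : ((normc (a i) `^ p)%:E <= pmass mu p (blend a))%E.
Proof.
have mb := measurable_normc_powR p (cmeasurable_blend a).
apply: (@le_trans _ _ (\int[mu]_(z in S i) (normc (blend a z) `^ p)%:E)%E); last first.
  by apply: ge0_subset_integral => // z _; rewrite lee_fin powR_ge0.
rewrite (_ : (\int[mu]_(z in S i) _)%E = (\int[mu]_(z in S i)
    ((normc (a i) `^ p)%:E * (normc (psi z) `^ p)%:E))%E).
  rewrite ge0_integralZl_EFin ?powR_ge0//.
  - by rewrite psiS mule1.
  - by move=> z _; rewrite lee_fin powR_ge0.
  - by apply: measurable_funTS; exact: measurable_normc_powR.
apply: eq_integral => z; rewrite inE => /Sj /= jz.
by rewrite /blend jz -EFinM normcM powRM ?normc_ge0.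
Qed.

Definition has_coefs (a : nat -> R[i]) (x : Lp) :=
  exists2 g : ty, (g : T -> R[i]) = blend a & x = \pi_Lp g.

Lemma has_coefsD a b x y : has_coefs a x -> has_coefs b y ->
  has_coefs (fun i => a i + b i) (x + y).
Proof.
move=> [g ga ->] [h hb ->]; exists (g + h); last by rewrite cLpiD.
apply/funext => z; change (g z + h z = blend (fun i => a i + b i) z).
by rewrite ga hb /blend mulrDl.
Qed.

Lemma has_coefsZ c a x : has_coefs a x -> has_coefs (fun i => c * a i) (c *: x).
Proof.
move=> [g ga ->]; exists (c *: g); last by rewrite cLpiZ.
apply/funext => z; change (c * g z = blend (fun i => c * a i) z).
by rewrite ga /blend mulrA.
Qed.

Lemma has_coefs0 : has_coefs (fun=> 0) 0.
Proof.
exists 0; last by rewrite cLpi0.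
by apply/funext => z; change (0 = blend (fun=> 0) z); rewrite /blend mul0r.
Qed.

Lemma has_coefs_sum (I : finType) (c : I -> R[i]) a x :
  (forall l, has_coefs (a l) (x l)) ->
  has_coefs (fun i => \sum_l c l * a l i) (\sum_l c l *: x l).
Proof.
move=> ax; rewrite (_ : (fun i => _) = \sum_l (fun i => c l * a l i)); last first.
  by apply/funext => i; rewrite fct_sumE.
apply: (big_ind2 has_coefs); first exact: has_coefs0.
- by move=> ? ? ? ? h1 h2; exact: has_coefsD.
- by move=> l _; exact: has_coefsZ.
Qed.

Lemma coef_le_norm a x i : has_coefs a x -> (normc (a i))%:C <= `|x|.
Proof.
move=> [g ga ->]; rewrite cLspace_normE lecR leNgt; apply/negP => h.
have a0 : 0 < normc (a i) by apply: le_lt_trans h; rewrite fine_ge0// cLnorm_ge0.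
have : `|\pi_Lp g| < (normc (a i))%:C by rewrite cLspace_normE ltcR.
by rewrite norm_pi_lt// ltNge => /negP; apply; rewrite ga; exact: coef_le_pmass.
Qed.

Definition blend_space : set Lp := [set x | exists a, has_coefs a x].

Lemma blend_space_linear : linear_subspace blend_space.
Proof.
split; first by exists (fun=> 0); exact: has_coefs0.
- by move=> x y [a ax] [b by_]; exists (fun i => a i + b i); exact: has_coefsD.
- by move=> c x [a ax]; exists (fun i => c * a i); exact: has_coefsZ.
Qed.

Definition fibre_psi i : ty := CLfun p1 (psi_fibre i).

Lemma fibre_psi_coefs i : has_coefs (fun k => (k == i)%:R) (\pi_Lp (fibre_psi i)).
Proof.
exists (fibre_psi i) => //; apply/funext => z.
by rewrite /= /fibre_cut /blend; case: eqP => _; rewrite ?mul1r ?mul0r.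
Qed.

(** The functions psi restricted to n + 1 fibres would be combinations of n blends;
    comparing coefficients factors the identity matrix of size n + 1 through
    dimension n. *)
Lemma blend_space_infinite : ~ finite_dimensional blend_space.
Proof.
move=> [n [e [eV espan]]].
have /choice[A hA] l : exists a, has_coefs a (e l) := eV l.
have /choice[c hc] (k : 'I_n.+1) : exists c : 'I_n -> R[i],
    \pi_Lp (fibre_psi k) = \sum_(l < n) c l *: e l.
  by apply: espan; eexists; exact: fibre_psi_coefs.
suff : (\matrix_(k < n.+1, l < n) c k l) *m (\matrix_(l < n, i < n.+1) A l i) =
    1%:M.
  by move=> /mulmx1_min; rewrite ltnn.
apply/matrixP => k i; rewrite !mxE.
have := has_coefsD (fibre_psi_coefs k)
  (has_coefsZ (-1) (has_coefs_sum (c k) hA)).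
rewrite -hc scaleN1r subrr => /(coef_le_norm i).
rewrite normr0 lecR => h.
have /eqP : normc ((i == k :> nat)%:R + -1 * \sum_l c k l * A l i) = 0.
  by apply/eqP; rewrite eq_le h normc_ge0.
move=> /eqP /eq0_normc /eqP; rewrite mulN1r subr_eq0 => /eqP hk.
rewrite eq_sym in hk; rewrite hk; apply: eq_bigr => l _; by rewrite !mxE.
Qed.

Lemma cut_cLfun i (g : ty) : fibre_cut i g \in cLfun mu p.
Proof.
have := cLfun_funP g => /(cLfun_pmass _ p1)[mg pg]; apply/(cLfun_pmass _ p1).
split; first exact: cmeasurable_cut.
apply: le_lt_trans pg; apply: le_pmass => //; first exact: cmeasurable_cut.
by move=> z; rewrite /fibre_cut; case: eqP => // _; rewrite normc0 normc_ge0.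
Qed.

Lemma norm_cut_lt i (g h : ty) (e : R) : 0 < e -> (h : T -> R[i]) = fibre_cut i g ->
  `|\pi_Lp g| < e%:C -> `|\pi_Lp h| < e%:C.
Proof.
move=> e0 hg; rewrite (norm_pi_lt g e0) (norm_pi_lt h e0); apply: le_lt_trans.
rewrite hg; apply: le_pmass => //; [|exact: cLfun_measurable|].
  by apply: cmeasurable_cut; exact: cLfun_measurable.
by move=> z; rewrite /fibre_cut; case: eqP => // _; rewrite normc0 normc_ge0.
Qed.

(** The coefficients of approximating blends converge, each at a known rate since
    it is bounded by the norm.  Fibre by fibre the limit is then a multiple of psi,
    and there are countably many fibres. *)
Lemma blend_space_closed : closed blend_space.
Proof.
apply: closed_norm; elim/cLspaceW => Y hY.
pose e (n : nat) : R := n.+1%:R^-1.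
have e0 n : 0 < e n by rewrite invr_gt0.
have /choice[ag hag] n : exists ag : (nat -> R[i]) * ty,
    (ag.2 : T -> R[i]) = blend ag.1 /\ `|\pi_Lp Y - \pi_Lp ag.2| < (e n)%:C.
  by have [s [a [g ga ->]] hs] := hY _ (e0 n); exists (a, g).
pose a n := (ag n).1; pose g n := (ag n).2.
have ga n : (g n : T -> R[i]) = blend (a n) by have [] := hag n.
have gY n : `|\pi_Lp Y - \pi_Lp (g n)| < (e n)%:C by have [] := hag n.
have cg n : has_coefs (a n) (\pi_Lp (g n)) by exists (g n).
have /choice[b hb] i : exists x, forall n, normc (a n i - x) <= 2 * e n.
  apply: complex_limit_of_errors => n l.
  have := coef_le_norm i (has_coefsD (cg n) (has_coefsZ (-1) (cg l))).
  rewrite mulN1r scaleN1r => h; rewrite -lecR; apply: (le_trans h).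
  rewrite (_ : _ - _ = (\pi_Lp Y - \pi_Lp (g l)) - (\pi_Lp Y - \pi_Lp (g n))); last first.
    by rewrite opprB [RHS]addrC addrA subrK.
  apply: le_trans (ler_normB _ _) _.
  by rewrite rmorphD addrC lerD// ltW.
have Yi i : {ae mu, forall z, j z = i -> Y z = b i * psi z}.
  pose cutY : ty := CLfun p1 (cut_cLfun i Y).
  pose D : ty := cutY - b i *: fibre_psi i.
  have small n : `|\pi_Lp D| <= (e n)%:C + (2 * e n)%:C * `|\pi_Lp (fibre_psi i)|.
    pose cutYg : ty := CLfun p1 (cut_cLfun i (Y - g n)).
    have -> : D = cutYg + (a n i - b i) *: fibre_psi i.
      apply: val_inj; apply/funext => z.
      change (fibre_cut i Y z - b i * fibre_cut i psi z =
        fibre_cut i (Y - g n : ty) z + (a n i - b i) * fibre_cut i psi z).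
      rewrite /fibre_cut; case: eqP => [jz|_]; last by rewrite !mulr0 subr0 addr0.
      rewrite (_ : (Y - g n : ty) z = Y z - g n z)// ga /blend jz; by ring.
    rewrite cLpiD cLpiZ; apply: le_trans (ler_normD _ _) _; apply: lerD.
      by apply/ltW; apply: (norm_cut_lt (e0 n)) => //; rewrite cLpiB.
    by rewrite normrZ ler_wpM2r// normcC lecR hb.
  have D0 : \pi_Lp D = 0.
    apply: (@norm_eq0_of_small _ _ _ (1 + 2 * complex.Re `|\pi_Lp (fibre_psi i)|)).
    move=> n; apply: le_trans (small n) _.
    rewrite [X in _ + _ * X <= _]complex_ge0E// -rmorphM -rmorphD lecR.
    by rewrite /e [leRHS]mulrDl mul1r mulrAC.
  move: D0; rewrite -cLpi0 => /cLspaceP; apply: filterS => z + jz => /(_ I).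
  rewrite -[(D : T -> R[i]) z]/(fibre_cut i Y z - b i * fibre_cut i psi z).
  rewrite /fibre_cut jz eqxx => /eqP.
  by rewrite -[(0 : ty) z]/(0 : R[i]) subr_eq0 => /eqP.
have Yb : (Y : T -> R[i]) = blend b %[ae mu].
  have /ae_foralln := Yi; apply: filterS => z h _; exact: h.
have bL : blend b \in cLfun mu p.
  apply/cLfunP; split; first exact: cmeasurable_blend.
  rewrite -(@cLnorm_ae_eq _ _ _ mu p _ _ _ _ Yb) //; last 2 first.
  - exact: cLfun_measurable.
  - exact: cmeasurable_blend.
  by have /cLfunP[] := cLfun_funP Y.
exists b, (CLfun p1 bL) => //; exact/cLspaceP.
Qed.
End blends.

(** * Vanishing integrals and unbounded codes *)

Section vanishing_integrals.
Context {d} {T : measurableType d} {R : realType}.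
Variable mu : {measure set T -> \bar R}.

(** Dominated convergence for nonnegative functions with limit 0, in the
    form of eventual inequalities. *)
Lemma dominated_integrals_vanish (u : nat -> T -> R) (G : T -> R) :
  (forall s, measurable_fun setT (u s)) -> measurable_fun setT G ->
  (\int[mu]_z (G z)%:E < +oo)%E -> (forall s z, 0 <= u s z <= G z) ->
  (forall z, u s z @[s --> \oo] --> 0) ->
  forall e, 0 < e -> \forall s \near \oo, (\int[mu]_z (u s z)%:E < e%:E)%E.
Proof.
move=> um Gm Goo uG u0 e e0.
have G0 z : 0 <= G z by have /andP[+ ] := uG 0%N z; exact: le_trans.
have iG : mu.-integrable setT (EFin \o G).
  apply/integrableP; split; first exact/measurable_EFinP.
  by under eq_integral do rewrite /= ger0_norm//.
have [|||||_ _] := @dominated_convergence _ _ _ mu setT measurableT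
  (fun s z => (u s z)%:E) (cst 0%E) (EFin \o G).
- by move=> s; exact/measurable_EFinP.
- exact: measurable_cst.
- by apply: nearW => z _; apply/cvg_EFin; [exact: nearW|exact: u0].
- exact: iG.
- apply: nearW => z s _ /=; have /andP[us uGs] := uG s z.
  by rewrite lee_fin ger0_norm.
rewrite integral0 => /(_ [set x | (x < e%:E)%E]); apply.
by apply: open_nbhs_nbhs; split; [exact: open_ereal_lt_ereal|rewrite /= lte_fin].
Qed.
End vanishing_integrals.

Section unbounded_codes.
Lemma injective_unbounded (f : nat -> nat) (N : nat) :
  injective f -> exists l, (N <= f l)%N.
Proof.
move=> fI; apply: contrapT => nex.
have fN l : (f l < N)%N by rewrite ltnNge; apply/negP => ?; apply: nex; exists l.
have : injective (fun l : 'I_N.+1 => Ordinal (fN l)).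
  by move=> a b /(congr1 val) /= /fI /val_inj.
by move=> /leq_card; rewrite !card_ord ltnn.
Qed.
End unbounded_codes.

(** * Schedules *)

Section schedules.
Variable R : realType.

(** The data of the construction.  Block t consists of the levels within t of n t;
    cost t stands for the mass of its function on the levels |k| <= t, before it
    is moved to the block; r enumerates the peaks.  The lookups block
    and peak invert the two enumerations.  The conditions past and future bound the
    weight of block t as seen after time n s, for s < t and for s > t. *)
Record schedule (m : int -> R) (cost : nat -> R) (n : nat -> nat)
    (block peak : int -> option nat) (r : nat -> int) : Prop := Schedule {
  schedule_block : forall k t, block k = Some t <-> (`|k - (n t)%:Z| <= t)%N ;
  schedule_peak : forall k i, peak k = Some i <-> k = r i ;
  schedule_apart : forall i, block (r i) = None ;
  schedule_past : forall t (j : int), (`|j| <= t)%N ->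
    (m (j + (n t)%:Z) + \sum_(s < t) m (j + (n t)%:Z - (n s)%:Z)) * cost t <=
    (2 ^ t.+1)%:R^-1 * m j ;
  schedule_future : forall s t (j : int), (t < s)%N -> (`|j| <= t)%N ->
    m (j + (n t)%:Z - (n s)%:Z) <= m (j + (n t)%:Z) ;
  schedule_peaks : forall s i, m (r i - (n s)%:Z) <= m (r i) ;
  schedule_vanish : forall k, m (k - (n s)%:Z) @[s --> \oo] --> 0 }.

Lemma partial_index (P : nat -> int -> Prop) :
  (forall k t t', P t k -> P t' k -> t = t') ->
  exists ix : int -> option nat, forall k t, ix k = Some t <-> P t k.
Proof.
move=> Puniq.
suff /choice[ix h] k : exists o : option nat, forall t, o = Some t <-> P t k.
  by exists ix.
have [[t Pt]|nP] := pselect (exists t, P t k).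
  by exists (Some t) => t'; split=> [[<-]|/(Puniq _ _ _ Pt)->].
by exists None => t; split=> // Pt; exfalso; apply: nP; exists t.
Qed.

Lemma schedule_exists (m : int -> R) (c : R) (cost : nat -> R) :
  (forall k, 0 < m k) -> 1 <= c ->
  (forall k, m (k + 1) <= c * m k) -> (forall k, m (k - 1) <= c * m k) ->
  (forall e, 0 < e -> exists n : nat, m n%:Z < e /\ m (- n%:Z) < e) ->
  (forall t, 0 <= cost t) ->
  exists n block peak r, schedule m cost n block peak r.
Proof.
move=> m0 c1 mS mP msmall cost0.
have c0 : 0 < c by exact: lt_le_trans c1.
(* the three factors absorb the t + 1 terms of the sum, the cost, and the power of 2 *)
pose eta t : R := m 0 / c ^+ t / (t.+1%:R * (cost t + 1) * (2 ^ t.+1)%:R).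
have cost1 t : 0 < cost t + 1 by rewrite ltr_wpDl.
have p2 t : 0 < (2 ^ t.+1)%:R :> R by rewrite ltr0n expn_gt0.
have eta0 t : 0 < eta t.
  by rewrite !divr_gt0 ?exprn_gt0// !mulr_gt0.
have [n [r [[nt nst] past future [r0 rmono peaks] small]]] :=
  stages m0 c1 mS mP msmall eta0.
have [block blockP] : exists ix : int -> option nat,
    forall k t, ix k = Some t <-> (`|k - (n t)%:Z| <= t)%N.
  apply: partial_index => k t t' kt kt'.
  have [tt'|t't|//] := ltngtP t t'; first by have := nst _ _ tt'; lia.
  by have := nst _ _ t't; lia.
have [peak peakP] : exists ix : int -> option nat,
    forall k i, ix k = Some i <-> k = - (r i)%:Z.
  apply: partial_index => k i i' ki ki'.
  have [ii'|i'i|//] := ltngtP i i'; first by have := rmono _ _ ii'; lia.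
  by have := rmono _ _ i'i; lia.
exists n, block, peak, (fun i => - (r i)%:Z); split => //.
- move=> i; case E : block => [t|//]; move/blockP: E.
  by have := nt t; have := r0 i; lia.
- move=> t j jt; have [past0 pasts] := past t j jt.
  have lo : m 0 / c ^+ t <= m j by exact: (weight_low m0 c1 mS mP).
  apply: (@le_trans _ _ (t.+1%:R * eta t * cost t)).
    apply: ler_wpM2r => //.
    rewrite -natr1 mulrDl mul1r addrC lerD// mulr_natl.
    rewrite -[X in _ *+ X](card_ord t) -sumr_const.
    by apply: ler_sum => s _; exact: pasts.
  apply: (@le_trans _ _ ((2 ^ t.+1)%:R^-1 * (m 0 / c ^+ t))); last first.
    by apply: ler_wpM2l => //; rewrite invr_ge0 ltW.
  have -> : t.+1%:R * eta t * cost t =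
      (2 ^ t.+1)%:R^-1 * (m 0 / c ^+ t) * (cost t / (cost t + 1)).
    rewrite /eta; field.
    by rewrite !gt_eqF ?exprn_gt0.
  rewrite ger_pMr; last by rewrite !mulr_gt0 ?invr_gt0 ?exprn_gt0.
  by rewrite ler_pdivrMr// mul1r lerDl.
- move=> k.
  apply: (@squeeze_cvgr _ _ _ _ (cst 0) (fun s => c ^+ `|k|%N * s.+1%:R^-1)).
  + apply: nearW => s; rewrite ltW//=.
    apply: le_trans (_ : _ <= c ^+ `|k|%N * m (- (n s)%:Z)) _.
      by rewrite addrC; exact: (weight_shift m0 c1 mS mP).
    by rewrite ler_wpM2l ?exprn_ge0// ltW.
  + exact: cvg_cst.
  + rewrite -(mulr0 (c ^+ `|k|%N)); apply: cvgMr; exact: cvg_harmonic.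
Qed.
End schedules.

(** * The universal profile and the hypercyclic subspace *)

Section universal_blend.
Context {d} {T : measurableType d} {R : realType}.
Variables (mu : {measure set T -> \bar R}) (p : R) (p1 : 1 <= p).
Let p0 : 0 < p. Proof. exact: lt_le_trans p1. Qed.
Local Notation ty := (cLfunType mu p1).
Local Notation Lp := (cLspace mu p1).

Variables (f : T -> T) (hf : composition_map mu f).
Variables (F : int -> T -> T) (kappa : T -> int) (m : int -> R) (C : R).
Hypothesis tower : distorted_tower mu f F kappa m C.
Let tlev := tower_level tower.
Let tmeas := tower_measurable tower.
Let m0 := tower_mass_gt0 tower.
Let C0 := tower_const_ge0 tower.

Variables (h : ty) (label power : nat -> nat).

Definition orbit_mass (k : nat) : R := fine (pmass mu p (fun z => h (F k z))).

Variables (n : nat -> nat) (block peak : int -> option nat) (r : nat -> int).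
Hypothesis sched :
  schedule m (fun t => C * orbit_mass (power t) + 1) n block peak r.

Lemma integral_tower l (g : T -> \bar R) : (forall z, 0 <= g z)%E ->
  measurable_fun setT g ->
  (\int[mu]_z g (F l z) <=
   C%:E * \int[mu]_z ((flow_density m l (kappa z))%:E * g z))%E.
Proof. exact: (integral_flow tlev tmeas m0 C0 (tower_distortion tower)). Qed.

Lemma cmeasurable_flow k (g : T -> R[i]) : cmeasurable g ->
  cmeasurable (fun z => g (F k z)).
Proof.
by move=> [g1 g2]; split; [exact: (measurableT_comp g1 (tmeas k))|
  exact: (measurableT_comp g2 (tmeas k))].
Qed.

Lemma cmeasurable_level_pieces (u : int -> T -> R[i]) :
  (forall k, cmeasurable (u k)) -> cmeasurable (fun z => u (kappa z) z).
Proof.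
move=> hu; split.
- by apply: (measurable_pieces tlev (u := fun k z => complex.Re (u k z))) => k;
    have [] := hu k.
- by apply: (measurable_pieces tlev (u := fun k z => complex.Im (u k z))) => k;
    have [] := hu k.
Qed.

Lemma cmeasurable_cst (a : R[i]) : cmeasurable (fun _ : T => a).
Proof. by split; exact: measurable_cst. Qed.

Lemma iter_flowE k (g : ty) z : iter k (cLfun_comp hf) g z = g (F k z).
Proof. by rewrite iter_cLfun_compE (tower_iter tower). Qed.

Lemma pmass_flow_fin k (g : ty) : (pmass mu p (fun z => g (F (Posz k) z)) < +oo)%E.
Proof.
have := cLfun_funP (iter k (cLfun_comp hf) g) => /(cLfun_pmass _ p1)[_].
rewrite (_ : (fun z => g (F k z)) = iter k (cLfun_comp hf) g)//.
by apply/funext => z; rewrite iter_flowE.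
Qed.

Lemma orbit_massE k : pmass mu p (fun z => h (F (Posz k) z)) = (orbit_mass k)%:E.
Proof. by rewrite fineK// ge0_fin_numE ?pmass_ge0// pmass_flow_fin. Qed.

Lemma orbit_mass_ge0 k : 0 <= orbit_mass k.
Proof. by rewrite fine_ge0// pmass_ge0. Qed.

(** On block t this is the function which the time n t carries to the orbit of h
    at time power t; on a peak it is the constant of p-th power mass 1. *)
Definition profile_at (k : int) (z : T) : R[i] :=
  match block k with
  | Some t => h (F ((power t)%:Z - (n t)%:Z) z)
  | None => if peak k is Some _ then (m k `^ (- p^-1))%:C else 0
  end.

Definition profile (z : T) : R[i] := profile_at (kappa z) z.

(** The default label is harmless, since the profile vanishes on the levels outside
    all blocks and peaks. *)
Definition level_label (k : int) : nat :=
  match block k with Some t => label t | None => odflt 0%N (peak k) end.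

Definition point_label (z : T) : nat := level_label (kappa z).

Lemma cmeasurable_profile_at k : cmeasurable (profile_at k).
Proof.
rewrite /profile_at; case: block => [t|]; last first.
  by case: peak => [_|]; exact: cmeasurable_cst.
apply: cmeasurable_flow; exact: cLfun_measurable.
Qed.

Lemma cmeasurable_profile : cmeasurable profile.
Proof. exact: (cmeasurable_level_pieces cmeasurable_profile_at). Qed.

Lemma measurable_point_label i : measurable (point_label @^-1` [set i]).
Proof. exact: (measurable_level tlev [set k | level_label k = i]). Qed.

Definition peak_set (i : nat) : set T := kappa @^-1` [set (r i)].

Lemma peak_r i : peak (r i) = Some i.
Proof. exact/(schedule_peak sched). Qed.

Lemma peak_set_label i : peak_set i `<=` point_label @^-1` [set i].
Proof.
move=> z; rewrite /peak_set /= /point_label => ->.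
by rewrite /level_label (schedule_apart sched) peak_r.
Qed.

Lemma profile_peak i : (\int[mu]_(z in peak_set i) (normc (profile z) `^ p)%:E = 1)%E.
Proof.
rewrite (eq_integral (cst (m (r i))^-1%:E)); last first.
  move=> z; rewrite inE /peak_set /= /profile /profile_at => ->.
  rewrite (schedule_apart sched) peak_r normc_real ger0_norm ?powR_ge0//.
  by rewrite -powRrM mulNr mulVf ?lt0r_neq0// powR_inv1// ltW.
rewrite integral_cst; last exact: tlev.
by rewrite (tower_mass tower) -EFinM mulVf// lt0r_neq0.
Qed.

Local Notation density := (flow_density m).

(** At time n s with s < t the density on block t may exceed 1, and on this
    block the sum of the finitely many such densities dominates each of them.
    The constant 1 makes the majorant control the mass of the profile too. *)
Definition majorant (z : T) : R :=
  if block (kappa z) is Some t then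
    normc (profile z) `^ p * (1 + \sum_(s < t) density (n s)%:Z (kappa z))
  else 0.

Lemma density_ge0 l k : 0 <= density l k.
Proof. exact: flow_density_ge0. Qed.

Lemma majorant_ge0 z : 0 <= majorant z.
Proof.
rewrite /majorant; case: block => // t.
by rewrite mulr_ge0 ?powR_ge0// addr_ge0// sumr_ge0// => s _; exact: density_ge0.
Qed.

Lemma measurable_majorant : measurable_fun setT majorant.
Proof.
apply: (measurable_pieces tlev (u := fun k z => if block k is Some t then
    normc (profile_at k z) `^ p * (1 + \sum_(s < t) density (n s)%:Z k)
  else 0)) => k.
case: block => [t|]; last exact: measurable_cst.
apply: measurable_funM; last exact: measurable_cst.
by apply/measurable_EFinP; apply: measurable_normc_powR; exact: cmeasurable_profile_at.
Qed.

(** Moving block t back to the levels |k| <= t by the time n t turns the density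
    times the profile into the p-th power of the orbit of h, weighted by ratios
    which the schedule keeps below a summable sequence divided by the cost. *)
Lemma block_majorant t :
  (\int[mu]_(z in kappa @^-1` [set k | block k = Some t]) (majorant z)%:E <=
   (2 ^ t.+1)%:R^-1%:E)%E.
Proof.
pose phi (y : T) : R := if (`|kappa y| <= t)%N then
  normc (h (F (power t) y)) `^ p *
    (1 + \sum_(s < t) density (n s)%:Z (kappa y + (n t)%:Z)) else 0.
have phi0 y : 0 <= phi y.
  rewrite /phi; case: ifP => // _.
  by rewrite mulr_ge0 ?powR_ge0// addr_ge0// sumr_ge0// => s _; exact: density_ge0.
have mhp k : measurable_fun setT (fun y => normc (h (F k y)) `^ p).
  apply/measurable_EFinP; apply: measurable_normc_powR.
  by apply: cmeasurable_flow; exact: cLfun_measurable.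
have mphi : measurable_fun setT phi.
  apply: (measurable_pieces tlev (u := fun k y => if (`|k| <= t)%N then
    normc (h (F (power t) y)) `^ p *
    (1 + \sum_(s < t) density (n s)%:Z (k + (n t)%:Z)) else 0)) => k.
  case: (`|k| <= t)%N; last exact: measurable_cst.
  by apply: measurable_funM; [exact: mhp|exact: measurable_cst].
rewrite integral_mkcond.
rewrite (_ : (\int[mu]_z _)%E = (\int[mu]_z (phi (F (- (n t)%:Z) z))%:E)%E); last first.
  apply: eq_integral => z _; rewrite /patch /phi (tower_shift tower).
  have [bz|bz] := eqVneq (block (kappa z)) (Some t).
    rewrite mem_set// /majorant bz subrK.
    move: (bz) => /(schedule_block sched) ->.
    rewrite -(tower_iterD tower) /profile /profile_at bz.
    by [].
  rewrite memNset; last by move/eqP: bz.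
  case: ifP => // kz; exfalso; move/eqP: bz; apply.
  exact/(schedule_block sched).
apply: le_trans (integral_tower (- (n t)%:Z) (g := fun y => (phi y)%:E) _ _) _.
- by move=> y; rewrite lee_fin.
- exact/measurable_EFinP.
pose K := C * orbit_mass (power t) + 1.
have K0 : 0 < K by rewrite /K ltr_wpDl// mulr_ge0// orbit_mass_ge0.
pose B : R := (2 ^ t.+1)%:R^-1 / K.
have B0 : 0 <= B by rewrite divr_ge0// ltW.
have hB y : density (- (n t)%:Z) (kappa y) * phi y <=
    B * (normc (h (F (power t) y)) `^ p).
  rewrite /phi; case: ifP => kt; last by rewrite mulr0 mulr_ge0// powR_ge0.
  rewrite mulrCA [leRHS]mulrC ler_wpM2l ?powR_ge0//.
  rewrite /flow_density opprK -[X in X + \sum_(_ < _) _](mulfV (lt0r_neq0 (m0 (kappa y + (n t)%:Z)))).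
  rewrite -mulr_suml -mulrDl.
  rewrite mulrC mulrA divfK ?lt0r_neq0//.
  rewrite /B ler_pdivrMr//.
  rewrite mulrAC ler_pdivlMr//; exact: (schedule_past sched).
apply: (@le_trans _ _ (C%:E * (B%:E * (orbit_mass (power t))%:E))%E).
  apply: lee_wpmul2l; first by rewrite lee_fin.
  rewrite -orbit_massE -ge0_integralZl_EFin//; last 2 first.
  - by move=> y _; rewrite lee_fin powR_ge0.
  - by apply/measurable_EFinP.
  apply: ge0_le_integral => //.
  - by move=> y _; rewrite -EFinM lee_fin mulr_ge0// density_ge0.
  - apply: emeasurable_funM; first exact: measurable_flow_density.
    exact/measurable_EFinP.
  - by apply: emeasurable_funM => //; apply/measurable_EFinP.
  - by move=> y _; rewrite -!EFinM lee_fin hB.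
rewrite -!EFinM lee_fin /B.
rewrite (_ : C * _ = (2 ^ t.+1)%:R^-1 * (C * orbit_mass (power t) / K)); last by ring.
by rewrite ler_piMr// ler_pdivrMr// mul1r /K lerDl.
Qed.

Lemma integral_majorant_fin : (\int[mu]_z (majorant z)%:E < +oo)%E.
Proof.
(* code 0 collects the levels outside all blocks, where the majorant is 0; the shift
   by one is compensated by the factor 2 of the geometric series *)
pose code (o : option nat) := if o is Some t then t.+1 else 0%N.
pose A (i : nat) := kappa @^-1` [set k | code (block k) = i].
have mA i : measurable (A i) by exact: measurable_level.
have AT : \bigcup_i A i = setT.
  by apply/seteqP; split => // z _; exists (code (block (kappa z))).
rewrite -[X in (\int[_]_(z in X) _)%E]AT ge0_integral_bigcup//; last 3 first.
- by apply: measurable_funTS; apply/measurable_EFinP; exact: measurable_majorant.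
- by move=> z _; rewrite lee_fin majorant_ge0.
- by move=> i l _ _ [z [/= <- <-]].
apply: le_lt_trans (ltry 2); apply: le_trans (epsilon_trick0 xpredT (ler0n R 2)).
apply: lee_nneseries => [i _ _|i _].
  by apply: integral_ge0 => z _; rewrite lee_fin majorant_ge0.
case: i => [|t].
  rewrite (eq_integral (cst 0%E)) ?integral0; first by rewrite lee_fin divr_ge0.
  by move=> z; rewrite inE /A /= /majorant; case: block.
have -> : A t.+1 = kappa @^-1` [set k | block k = Some t].
  by apply/seteqP; split => z; rewrite /A /=; case: block => //= a [->].
apply: le_trans (block_majorant t) _; rewrite lee_fin.
by rewrite [in leRHS]expnS natrM invfM mulrA divff// mul1r.
Qed.


(** The mass of a fibre of the profile is that of its peak, 1, plus at most that of
    the blocks, bounded by the integral of the majorant. *)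
Lemma profile_fibre_cLfun i : fibre_cut point_label i profile \in cLfun mu p.
Proof.
apply/(cLfun_pmass _ p1).
have mc : cmeasurable (fibre_cut point_label i profile).
  apply: cmeasurable_cut; first exact: measurable_point_label.
  exact: cmeasurable_profile.
split=> //.
pose peakpart := (fun z => (normc (profile z) `^ p)%:E) \_ (peak_set i).
have mpow : measurable_fun setT (fun z => (normc (profile z) `^ p)%:E).
  by apply: measurable_normc_powR; exact: cmeasurable_profile.
have mpeak : measurable_fun setT peakpart.
  by apply/(measurable_restrictT _ _).1 => //; [exact: tlev|exact: measurable_funTS].
have peakpart0 z : (0 <= peakpart z)%E.
  by rewrite /peakpart/patch; case: ifP => // _; rewrite lee_fin powR_ge0.
apply: (@le_lt_trans _ _ (\int[mu]_z ((majorant z)%:E + peakpart z))%E).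
  apply: ge0_le_integral => //.
  - by move=> z _; rewrite lee_fin powR_ge0.
  - exact: measurable_normc_powR.
  - by apply: emeasurable_funD => //; apply/measurable_EFinP; exact: measurable_majorant.
  move=> z _; rewrite /fibre_cut; case: eqP => [zi|_]; last first.
    rewrite normc0 powR0 ?lt0r_neq0//.
    by rewrite adde_ge0// lee_fin majorant_ge0.
  rewrite /majorant; case bz : block => [t|].
    apply: (@le_trans _ _ (normc (profile z) `^ p *
      (1 + \sum_(s < t) density (n s)%:Z (kappa z)))%:E); last by rewrite leeDl.
    rewrite lee_fin ler_peMr ?powR_ge0// lerDl sumr_ge0// => s _.
    exact: density_ge0.
  rewrite add0e; case pz : (peak (kappa z)) => [k|]; last first.
    by rewrite /profile /profile_at bz pz normc0 powR0 ?lt0r_neq0.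
  rewrite /peakpart/patch mem_set//.
  rewrite /peak_set /= -zi /point_label /level_label bz pz.
  exact/(schedule_peak sched).
rewrite ge0_integralD//; last 2 first.
- by move=> z _; rewrite lee_fin majorant_ge0.
- by apply/measurable_EFinP; exact: measurable_majorant.
rewrite -integral_mkcond profile_peak lte_add_pinfty ?ltry//.
exact: integral_majorant_fin.
Qed.

(** On peaks and on blocks t < s the density at time n s is at most 1; on
    blocks t > s it is part of the majorant.  Elsewhere outside block s the
    profile vanishes. *)
Lemma density_decay (a : nat -> R[i]) (A : R) s z :
  (forall i, normc (a i) `^ p <= A) -> block (kappa z) <> Some s ->
  normc (blend point_label profile a z) `^ p * density (n s)%:Z (kappa z) <=
  normc (blend point_label profile a z) `^ p + A * majorant z.
Proof.
move=> aA bs; set g := normc _ `^ p.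
have g0 : 0 <= g by exact: powR_ge0.
have A0 : 0 <= A by apply: le_trans (aA 0%N); exact: powR_ge0.
have le1 k : m (k - (n s)%:Z) <= m k -> density (n s)%:Z k <= 1.
  by move=> hk; rewrite /flow_density ler_pdivrMr// mul1r.
have dg : density (n s)%:Z (kappa z) <= 1 -> g * density (n s)%:Z (kappa z) <=
    g + A * majorant z.
  move=> d1; apply: (@le_trans _ _ g); first by rewrite ler_piMr.
  by rewrite lerDl mulr_ge0// majorant_ge0.
case bz : (block (kappa z)) => [t|].
  have kt := (schedule_block sched (kappa z) t).1 bz.
  have [ts|st|ts] := ltngtP t s.
  - apply: dg; apply: le1.
    by have := schedule_future sched ts kt; rewrite subrK.
  - apply: (@le_trans _ _ (A * majorant z)); last by rewrite lerDr.
    rewrite /majorant bz /g /blend normcM powRM ?normc_ge0// -mulrA.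
    apply: ler_pM => //; first exact: powR_ge0.
      by apply: mulr_ge0; [exact: powR_ge0|exact: density_ge0].
    rewrite ler_wpM2l ?powR_ge0// (bigD1 (Ordinal st))//= addrCA lerDl addr_ge0//.
    by rewrite sumr_ge0// => i _; exact: density_ge0.
  - by exfalso; apply: bs; rewrite bz ts.
case pz : (peak (kappa z)) => [i|].
  apply: dg; apply: le1; have /(schedule_peak sched) -> := pz.
  exact: (schedule_peaks sched).
rewrite (_ : g = 0) ?mul0r ?add0r ?mulr_ge0 ?majorant_ge0//.
by rewrite /g /blend /profile /profile_at bz pz mulr0 normc0 powR0// lt0r_neq0.
Qed.

Definition tail_cut (s : nat) (g : T -> R[i]) (z : T) : R[i] :=
  if (`|kappa z| <= s)%N then 0 else g z.

(** F (n s) carries the levels |k| > s onto the levels outside block s, so this mass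
    is at most C times the integral over the latter of the density at time n s. *)
Lemma off_block_vanishes (a : nat -> R[i]) (g : ty) :
  (g : T -> R[i]) = blend point_label profile a ->
  forall e, 0 < e -> \forall s \near \oo,
    (pmass mu p (tail_cut s (fun z => g (F (n s) z))) < e%:E)%E.
Proof.
move=> ga e e0.
have /(cLfun_pmass _ p1)[mg gfin] := cLfun_funP g.
pose A := fine (pmass mu p g).
have AE : pmass mu p g = A%:E by rewrite fineK// ge0_fin_numE ?pmass_ge0.
have aA i : normc (a i) `^ p <= A.
  rewrite -lee_fin -AE ga.
  apply: (coef_le_pmass measurable_point_label cmeasurable_profile
    (fun k => tlev (r k)) peak_set_label profile_peak).
pose u (s : nat) (z : T) : R := if block (kappa z) == Some s then 0 else
  normc (g z) `^ p.
have u0 s z : 0 <= u s z by rewrite /u; case: ifP => // _; exact: powR_ge0.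
have mpow : measurable_fun setT (fun z => normc (g z) `^ p).
  by apply/measurable_EFinP; exact: measurable_normc_powR.
have mu_ s : measurable_fun setT (u s).
  apply: (measurable_pieces tlev (u := fun k z =>
    if block k == Some s then 0 else normc (g z) `^ p)) => k.
  by case: (block k == Some s) => //; exact: measurable_cst.
have mdens s : measurable_fun setT (fun z => density (n s)%:Z (kappa z)).
  exact: (measurable_level_fun tlev (density (n s)%:Z)).
have C1 : 0 < C + 1 by rewrite ltr_wpDl.
have main : \forall s \near \oo, (\int[mu]_z (density (n s)%:Z (kappa z) * u s z)%:E < (e / (C + 1))%:E)%E.
  apply: (@dominated_integrals_vanish _ T R mu _
    (fun z => normc (g z) `^ p + A * majorant z)).
  - by move=> s; exact: measurable_funM.
  - apply: measurable_funD => //; apply: measurable_funM => //.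
    exact: measurable_majorant.
  - under eq_integral do rewrite EFinD EFinM.
    have A0 : 0 <= A by apply: le_trans (aA 0%N); exact: powR_ge0.
    rewrite ge0_integralD//; last 4 first.
    + by move=> z _; rewrite lee_fin powR_ge0.
    + exact/measurable_EFinP.
    + by move=> z _; rewrite -EFinM lee_fin mulr_ge0// majorant_ge0.
    + apply: emeasurable_funM => //; apply/measurable_EFinP.
      exact: measurable_majorant.
    rewrite ge0_integralZl_EFin//; last 2 first.
    + by move=> z _; rewrite lee_fin majorant_ge0.
    + by apply/measurable_EFinP; exact: measurable_majorant.
    rewrite lte_add_pinfty// lte_mul_pinfty ?lee_fin//.
    exact: integral_majorant_fin.
  - move=> s z; rewrite mulr_ge0 ?density_ge0//= /u; case: ifPn => [_|/eqP bz].
      by rewrite mulr0 addr_ge0 ?powR_ge0// mulr_ge0 ?majorant_ge0//;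
        apply: le_trans (aA 0%N); exact: powR_ge0.
    by rewrite mulrC ga; exact: density_decay.
  - move=> z; apply: (@squeeze_cvgr _ _ _ _ (cst 0)
      (fun s => normc (g z) `^ p / m (kappa z) * m (kappa z - (n s)%:Z))).
    + apply: nearW => s; rewrite mulr_ge0 ?density_ge0//=.
      rewrite [leRHS](_ : _ = density (n s)%:Z (kappa z) * normc (g z) `^ p); last first.
        by rewrite /flow_density; ring.
      rewrite ler_wpM2l ?density_ge0// /u; case: ifP => // _; exact: powR_ge0.
    + exact: cvg_cst.
    + rewrite -(mulr0 (normc (g z) `^ p / m (kappa z))); apply: cvgMr.
      exact: (schedule_vanish sched).
  - by rewrite divr_gt0.
near=> s.
apply: (@le_lt_trans _ _ (\int[mu]_z (u s (F (n s) z))%:E)%E).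
  rewrite /pmass le_eqVlt; apply/orP; left; apply/eqP; apply: eq_integral => z _.
  rewrite /u /tail_cut (tower_shift tower); case: ifPn => kz.
    rewrite (_ : block _ = Some s) ?eqxx ?normc0 ?powR0 ?lt0r_neq0//.
    by apply/(schedule_block sched); rewrite addrK.
  case: eqP => // /(schedule_block sched); by rewrite addrK (negbTE kz).
apply: le_lt_trans (integral_tower _ (g := fun z => (u s z)%:E) _ _) _.
- by move=> z; rewrite lee_fin.
- exact/measurable_EFinP.
under eq_integral do rewrite -EFinM.
apply: (@le_lt_trans _ _ (C%:E * (e / (C + 1))%:E)%E).
  apply: lee_wpmul2l; rewrite ?lee_fin//; apply: ltW; near: s; exact: main.
by rewrite -EFinM lte_fin mulrCA gtr_pMr// ltr_pdivrMr// mul1r ltrDl.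
Unshelve. all: by end_near.
Qed.

Lemma orbit_tail_vanishes k : forall e, 0 < e -> \forall s \near \oo,
  (pmass mu p (tail_cut s (fun z => h (F (Posz k) z))) < e%:E)%E.
Proof.
move=> e e0.
have mhp : measurable_fun setT (fun y => normc (h (F k y)) `^ p).
  apply/measurable_EFinP; apply: measurable_normc_powR.
  by apply: cmeasurable_flow; exact: cLfun_measurable.
apply: (@dominated_integrals_vanish _ T R mu _ (fun z => normc (h (F k z)) `^ p)) => //.
- move=> s; apply: (measurable_pieces tlev (u := fun k' z =>
    normc (if (`|k'| <= s)%N then 0 else h (F k z)) `^ p)) => k'.
  case: (`|k'| <= s)%N => //; exact: measurable_cst.
- exact: pmass_flow_fin.
- move=> s z; rewrite powR_ge0 /tail_cut/=; case: ifP => // _.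
  by rewrite normc0 powR0 ?lt0r_neq0// powR_ge0.
- move=> z; apply: cvg_near_cst; near=> s; rewrite /tail_cut.
  rewrite ifT ?normc0 ?powR0 ?lt0r_neq0//.
  near: s; exact: nbhs_infty_ge.
Unshelve. all: by end_near.
Qed.


Lemma tail_cut_cLfun s k (g : ty) :
  tail_cut s (fun z => g (F (Posz k) z)) \in cLfun mu p.
Proof.
have mg : cmeasurable (fun z => g (F k z)).
  by apply: cmeasurable_flow; exact: cLfun_measurable.
have mt : cmeasurable (tail_cut s (fun z => g (F k z))).
  apply: (cmeasurable_level_pieces (u := fun l z =>
    if (`|l| <= s)%N then 0 else g (F k z))) => l.
  by case: (`|l| <= s)%N => //; exact: cmeasurable_cst.
apply/(cLfun_pmass _ p1); split => //.
apply: le_lt_trans (pmass_flow_fin k g); apply: le_pmass => // z.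
by rewrite /tail_cut; case: ifP => // _; rewrite normc0 normc_ge0.
Qed.

Local Notation op := (composition_op p1 hf).

(** On the levels |k| <= s the two functions coincide; outside them each of the two
    is small for large s. *)
Lemma blend_orbit a x i k (e : R) : has_coefs point_label profile a x -> 0 < e ->
  \forall s \near \oo, label s = i -> power s = k ->
    `|iter (n s) op x - a i *: iter k op (\pi_Lp h)| < e%:C.
Proof.
move=> [g ga ->] e0.
pose c := normc (a i) + 1.
have c0 : 0 < c by rewrite ltr_wpDl// normc_ge0.
have e20 : 0 < e / 2 by rewrite divr_gt0.
have ec0 : 0 < e / 2 / c by rewrite divr_gt0.
have hu := off_block_vanishes ga (powR_gt0 p e20).
have hv := orbit_tail_vanishes k (powR_gt0 p ec0).
near=> s.
have us : (pmass mu p (tail_cut s (fun z => g (F (n s) z))) < ((e / 2) `^ p)%:E)%E.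
  by near: s; exact: hu.
have vs : (pmass mu p (tail_cut s (fun z => h (F k z))) < ((e / 2 / c) `^ p)%:E)%E.
  by near: s; exact: hv.
move=> si sk.
pose u : ty := CLfun p1 (tail_cut_cLfun s (n s) g).
pose v : ty := CLfun p1 (tail_cut_cLfun s k h).
have -> : iter (n s) op (\pi_Lp g) - a i *: iter k op (\pi_Lp h) =
    \pi_Lp u - a i *: \pi_Lp v.
  rewrite !iter_composition_op -!cLpiZ -!cLpiB; congr (\pi_Lp _).
  apply: val_inj; apply/funext => z.
  change (iter (n s) (cLfun_comp hf) g z - a i * iter k (cLfun_comp hf) h z =
    tail_cut s (fun z => g (F (n s) z)) z - a i * tail_cut s (fun z => h (F k z)) z).
  rewrite !iter_flowE /tail_cut; case: ifP => // kz.
  have bz : block (kappa (F (n s) z)) = Some s.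
    by apply/(schedule_block sched); rewrite (tower_shift tower) addrK.
  rewrite ga /blend /point_label /level_label /profile /profile_at bz si sk.
  by rewrite -(tower_iterD tower) subrK mulr0 !subrr.
apply: le_lt_trans (ler_normB _ _) _; rewrite normrZ normcC.
have un : `|\pi_Lp u| < (e / 2)%:C.
  by rewrite (norm_pi_lt u e20).
have vn : `|\pi_Lp v| < (e / 2 / c)%:C.
  by rewrite (norm_pi_lt v ec0).
rewrite [e]splitr rmorphD; apply: ltrD => //.
apply: (@le_lt_trans _ _ (c%:C * `|\pi_Lp v|)).
  by rewrite ler_wpM2r// lecR lerDl.
apply: (@lt_le_trans _ _ (c%:C * (e / 2 / c)%:C)).
  by rewrite ltr_pM2l// ltcR.
by rewrite -rmorphM mulrC divfK// lt0r_neq0.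
Unshelve. all: by end_near.
Qed.

Hypothesis codes_recur : forall i k N, exists s, [/\ (N <= s)%N, label s = i & power s = k].

Lemma blend_hypercyclic x : hypercyclic_vectors op (\pi_Lp h) ->
  blend_space point_label profile x -> x != 0 -> hypercyclic_vectors op x.
Proof.
move=> /dense_normP hd [a ax] x0.
have [i ai] : exists i, a i != 0.
  apply: contrapT => na; move/eqP: x0; apply.
  have {}na i : a i = 0 by apply: contrapT => /eqP ?; apply: na; exists i.
  case: ax => g ga ->; rewrite -cLpi0; congr (\pi_Lp _); apply: val_inj.
  by apply/funext => z; rewrite /= ga /blend na mul0r.
have nai : 0 < normc (a i).
  by rewrite lt_neqAle normc_ge0 andbT eq_sym; apply/eqP => /eq0_normc /eqP; exact/negP.
apply/dense_normP => y e e0.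
have e20 : 0 < e / 2 by rewrite divr_gt0.
have [_ [k _ <-] hk] := hd ((a i)^-1 *: y) _ (divr_gt0 e20 nai).
have [N _ hN] := blend_orbit i k ax e20.
have [s [Ns si sk]] := codes_recur i k N.
exists (iter (n s) op x); first by exists (n s).
have := hN s Ns si sk; set xs := iter _ _ x; set hk' := iter k op _ in hk *.
move=> xh.
rewrite (_ : y - xs = (y - a i *: hk') - (xs - a i *: hk')); last first.
  by rewrite opprB addrA subrK.
apply: le_lt_trans (ler_normB _ _) _; rewrite [e]splitr rmorphD; apply: ltrD => //.
rewrite (_ : y - a i *: hk' = a i *: ((a i)^-1 *: y - hk')); last first.
  by rewrite scalerBr scalerA divff// scale1r.
rewrite normrZ normcC.
apply: (@lt_le_trans _ _ ((normc (a i))%:C * (e / 2 / normc (a i))%:C)).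
  by rewrite ltr_pM2l// ltcR.
by rewrite -rmorphM mulrC divfK// lt0r_neq0.
Qed.

End universal_blend.

Theorem theorem3p2p2 (R : realType) (d : measure_display) (T : measurableType d)
    (mu : {sigma_finite_measure set T -> \bar R}) (p : R) (p1 : 1 <= p)
    (f : T -> T) (hf : composition_map mu f) :
  separable (cLspace mu p1) ->
  dissipative_bounded_distortion mu f ->
  hypercyclic (composition_op p1 hf) ->
  spaceable (hypercyclic_vectors (composition_op p1 hf)).
Proof.
move=> _ bd hyp.
have [F [kappa [m [C [tower [c c1 mc]]]]]] := tower_of_bounded_distortion hf bd.
have small := hypercyclic_small tower hyp.
case: hyp; elim/cLspaceW => h hh.
(* each triple (label, power, repetition) is coded once, so each pair recurs *)
pose dec (s : nat) : nat * nat := 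
  if (unpickle s : option (nat * nat * nat)) is Some (i, k, _) then (i, k)
  else (0%N, 0%N).
pose label s := (dec s).1; pose power s := (dec s).2.
have codes i k N : exists s, [/\ (N <= s)%N, label s = i & power s = k].
  have [l Nl] := @injective_unbounded (fun l => pickle (i, k, l)) N
    ltac:(by move=> l l' /(pcan_inj pickleK)[]).
  by exists (pickle (i, k, l)); rewrite /label /power /dec pickleK.
have [n [block [peak [r sched]]]] := @schedule_exists R m c
  (fun t => C * orbit_mass F h (power t) + 1) (tower_mass_gt0 tower) c1
  (fun k => (mc k).1) (fun k => (mc k).2) small
  ltac:(move=> t; rewrite addr_ge0// mulr_ge0 ?(tower_const_ge0 tower)// orbit_mass_ge0//).
have tlev := tower_level tower.
pose j := point_label kappa label block peak.
pose psi := profile F kappa m h power n block peak.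
have mj : forall i, measurable (j @^-1` [set i]) by exact: (measurable_point_label tower).
have mpsi : cmeasurable psi by exact: (cmeasurable_profile tower).
have mS i : measurable (peak_set kappa r i) by exact: tlev.
have Sj : forall i, peak_set kappa r i `<=` j @^-1` [set i] by exact: (peak_set_label label sched).
have psiS := profile_peak tower sched.
have psi_fibre := profile_fibre_cLfun hf tower label sched.
exists (blend_space (p1 := p1) j psi); split.
- exact: blend_space_linear.
- exact: (blend_space_closed mj mpsi mS Sj psiS psi_fibre).
- exact: (blend_space_infinite mj mpsi mS Sj psiS psi_fibre).
- move=> x Vx; have [->|x0] := eqVneq x 0; [by right|left].
  exact: (blend_hypercyclic tower sched codes hh Vx x0).
Qed.
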